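(* Let $n_1,n_2>1$ be integers such that $n=n_1+n_2$ is even and greater than $2$, and let $C=\{x\in\mathbb{R}^n\setminus\{0\}:x_1^2+\dots+x_{n_1}^2-x_{n_1+1}^2-\dots-x_n^2=0\}$. Any compactly supported smooth function $f\in C_0^\infty(C)$ can be recovered from the restriction to $\xi\in C$ of its Radon transform $\mathcal{R}f(\xi,t)$ alone; that is, if $f_1,f_2\in C_0^\infty(C)$ satisfy $\mathcal{R}f_1(\xi,t)=\mathcal{R}f_2(\xi,t)$ for all $\xi\in C$ and $t\in\mathbb{R}\setminus\{0\}$, then $f_1=f_2$.
   Context: Let $Q(x)=x_1^2+\dots+x_{n_1}^2-x_{n_1+1}^2-\dots-x_n^2$. $C$ carries the measure $d\mu$ given by a volume form with $dQ\wedge d\mu=dx_1\cdots dx_n$; in coordinates $x=(r\omega,r\eta)$, $r>0$, $\omega\in S^{n_1-1}$, $\eta\in S^{n_2-1}$, $d\mu=\frac12r^{n-3}\,dr\,d\omega\,d\eta$. For $f\in C_0^\infty(C)$, $\xi\in\mathbb{R}^n\setminus\{0\}$ and $t\ne0$, the (singular) Radon transform on $C$ is $$\mathcal{R}f(\xi,t)=\int_Cf(x)\,\delta(\langle x,\xi\rangle-t)\,d\mu(x),$$ where $\langle x,\xi\rangle=\sum_ix_i\xi_i$ and $\delta$ is the Dirac delta function of one variable; i.e. $t\mapsto\mathcal{R}f(\xi,t)$ is the density, on $\mathbb{R}\setminus\{0\}$, of the push-forward of the measure $f\,d\mu$ under $x\mapsto\langle x,\xi\rangle$. *)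

(* Defs.v *)
From HB Require Import structures.
From mathcomp Require Import all_boot all_order all_algebra.
From mathcomp Require Import complex.
From mathcomp Require Import all_classical all_reals all_analysis.
From mathcomp Require Import measurable_realfun.

Set Implicit Arguments.
Unset Strict Implicit.
Unset Printing Implicit Defensive.

Import Order.TTheory GRing.Theory Num.Theory.
Import numFieldNormedType.Exports.

Local Open Scope classical_set_scope.
Local Open Scope ring_scope.

Definition rV_measure_display : measure_display. Proof. exact. Qed.

(* Product sigma-algebra on R^n (generated by the coordinates); it is the Borel
   sigma-algebra. *)
Section measurable_rV.
Context {R : realType} {n : nat}.

Definition rV_coord (i : 'I_n) (x : 'rV[R]_n) : measurableTypeR R := x ord0 i.

Definition rV_measurable : set (set 'rV[R]_n) := g_sigma_preimage rV_coord.

Let rV_set0 : rV_measurable set0.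
Proof. exact: sigma_algebra0. Qed.

Let rV_setC A : rV_measurable A -> rV_measurable (~` A).
Proof. exact: sigma_algebraC. Qed.

Let rV_bigcup (F : (set 'rV[R]_n)^nat) : (forall i, rV_measurable (F i)) ->
  rV_measurable (\bigcup_i (F i)).
Proof. exact: sigma_algebra_bigcup. Qed.

HB.instance Definition _ := @isMeasurable.Build rV_measure_display
  'rV[R]_n rV_measurable rV_set0 rV_setC rV_bigcup.

Lemma measurable_rV_coord i : measurable_fun [set: 'rV[R]_n] (rV_coord i).
Proof.
move=> _ Y mY; rewrite setTI; apply: sub_sigma_algebra => /=.
rewrite -bigcup_seq/=; exists i => /=; first by rewrite mem_index_enum.
by exists Y => //; rewrite setTI.
Qed.

Lemma measurable_fun_rV d (T : measurableType d) (f : T -> 'rV[R]_n) :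
  (forall i, measurable_fun [set: T] (rV_coord i \o f)) ->
  measurable_fun [set: T] f.
Proof.
move=> mf.
suff H : g_sigma_preimage (fun i => rV_coord i \o f) `<=` measurable.
  by move: H; rewrite g_sigma_preimage_comp => H _ A mA; apply: H; exists A.
apply: smallest_sub; first exact: sigma_algebra_measurable.
elim/big_ind: _ => //; first by move=> A B HA HB C [/HA|/HB].
by move=> i _ A [B mB <-]; exact: mf.
Qed.

End measurable_rV.

Section with_sigma_finite.
Context d (T : measurableType d) (R : realType).

Let with_sf (mu : {measure set T -> \bar R}) of sigma_finite setT mu :
  set T -> \bar R := mu.

Context (mu : {measure set T -> \bar R}) (sf : sigma_finite setT mu).

HB.instance Definition _ := Measure.copy (with_sf sf) mu.
HB.instance Definition _ := Measure_isSigmaFinite.Build _ _ _ (with_sf sf) sf.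

Lemma sigma_finite_measureP : exists nu : {sigma_finite_measure set T -> \bar R},
  mu = nu :> (set T -> \bar R).
Proof. by exists (with_sf sf). Qed.

End with_sigma_finite.

Section euclidean.
Context {R : realType}.

(* The library's norm on 'rV[R]_n is the maximum norm. *)
Definition dotp n (x y : 'rV[R]_n) : R := \sum_i x ord0 i * y ord0 i.

Definition enorm n (x : 'rV[R]_n) : R := Num.sqrt (dotp x x).

Definition rV_cons n (p : measurableTypeR R * 'rV[R]_n) : 'rV[R]_n.+1 :=
  row_mx p.1%:M p.2 : 'rV[R]_(1 + n).

Fixpoint lebesgue_rV n : set 'rV[R]_n -> \bar R :=
  if n is m.+1 then
    pushforward (@lebesgue_measure R \x @lebesgue_rV m)%E (@rV_cons m)
  else \d_(0 : 'rV[R]_0).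

Lemma rV_cons0 n (p : measurableTypeR R * 'rV[R]_n) :
  rV_cons p ord0 ord0 = p.1.
Proof.
rewrite /rV_cons (_ : ord0 = lshift n ord0 :> 'I_(1 + n)); last exact: val_inj.
by rewrite (@row_mxEl _ 1 1 n) mxE eqxx mulr1n.
Qed.

Lemma rV_consS n (p : measurableTypeR R * 'rV[R]_n) i :
  rV_cons p ord0 (lift ord0 i) = p.2 ord0 i.
Proof.
rewrite /rV_cons (_ : lift ord0 i = rshift 1 i :> 'I_(1 + n)); last exact: val_inj.
by rewrite (@row_mxEr _ 1 1 n).
Qed.

Lemma measurable_rV_cons n : measurable_fun setT (@rV_cons n).
Proof.
apply: measurable_fun_rV => i; case: (unliftP ord0 i) => [j|] ->.
  rewrite (_ : _ \o _ = rV_coord j \o snd); last first.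
    by apply/funext => p; exact: rV_consS.
  exact: measurableT_comp (measurable_rV_coord j) _.
rewrite (_ : _ \o _ = fst); last by apply/funext => p; exact: rV_cons0.
exact: measurable_fst.
Qed.

Definition rV_cube n (k : nat) : set 'rV[R]_n :=
  [set x | forall i, x ord0 i \in `[- k%:R, k%:R]].

Lemma measurable_rV_cube n k : measurable (@rV_cube n k).
Proof.
rewrite (_ : rV_cube _ = \bigcap_(i in [set: 'I_n])
    (rV_coord i @^-1` [set` `[- k%:R, k%:R]])).
  apply: fin_bigcap_measurable => // i _; rewrite -[X in measurable X]setTI.
  exact: measurable_rV_coord.
by apply/seteqP; split=> [x /= h i _|x /= h i]; [exact: h|exact: (h i)].
Qed.

Lemma bigcup_rV_cube n : \bigcup_k @rV_cube n k = setT.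
Proof.
apply/seteqP; split=> // x _; exists (Num.truncn (\sum_i `|x ord0 i|)).+1 => //= i.
rewrite in_itv/= -ler_norml; apply: le_trans (ltW (truncnS_gt _)).
by rewrite (bigD1 i)//= lerDl sumr_ge0.
Qed.

Lemma rV_cons_cube n k : @rV_cons n @^-1` (rV_cube k) =
  [set` `[- k%:R, k%:R]] `*` rV_cube k.
Proof.
apply/seteqP; split => -[a v] /=.
  move=> h; split=> [|i]; first by have := h ord0; rewrite rV_cons0.
  by have := h (lift ord0 i); rewrite rV_consS.
by move=> [ha hv] i; case: (unliftP ord0 i) => [j|] ->; rewrite ?rV_consS ?rV_cons0.
Qed.

Lemma rV_cube_sigma_finite n (mu : {measure set 'rV[R]_n -> \bar R}) :
  (forall k, (mu (@rV_cube n k) < +oo)%E) -> sigma_finite setT mu.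
Proof.
move=> muk; exists (@rV_cube n); first by rewrite bigcup_rV_cube.
by move=> k; split => //; exact: measurable_rV_cube.
Qed.

Let lebesgue_rV_measure n : exists2 mu : {measure set 'rV[R]_n -> \bar R},
  @lebesgue_rV n = mu & forall k, (mu (@rV_cube n k) < +oo)%E.
Proof.
elim: n => [|n [mu muE muoo]].
  by exists \d_(0 : 'rV[R]_0) => // k; rewrite ltry.
have [nu munu] := sigma_finite_measureP (rV_cube_sigma_finite muoo).
exists (measure_function_pushforward__canonical__measure_function_Measure
  (@lebesgue_measure R \x nu)%E (@measurable_rV_cons n)).
  by rewrite /= muE munu.
move=> k; rewrite /= /pushforward rV_cons_cube.
rewrite product_measure1E//; last exact: measurable_rV_cube.
rewrite -munu; apply: lte_mul_pinfty => //.
by rewrite /= lebesgue_measure_itv/=; case: ifP => // _; rewrite -EFinB.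
Qed.

Let lebesgue_rV0 n : @lebesgue_rV n set0 = 0.
Proof. by have [mu -> _] := lebesgue_rV_measure n; rewrite measure0. Qed.

Let lebesgue_rV_ge0 n A : (0 <= @lebesgue_rV n A)%E.
Proof. by have [mu -> _] := lebesgue_rV_measure n. Qed.

Let lebesgue_rV_sigma_additive n : semi_sigma_additive (@lebesgue_rV n).
Proof.
by have [mu -> _] := lebesgue_rV_measure n; exact: measure_semi_sigma_additive.
Qed.

HB.instance Definition _ n := isMeasure.Build _ _ _ (@lebesgue_rV n)
  (@lebesgue_rV0 n) (@lebesgue_rV_ge0 n) (@lebesgue_rV_sigma_additive n).

Lemma lebesgue_rV_cube n k : (lebesgue_rV (@rV_cube n k) < +oo)%E.
Proof. by have [mu -> ] := lebesgue_rV_measure n. Qed.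

HB.instance Definition _ n := Measure_isSigmaFinite.Build _ _ _ (@lebesgue_rV n)
  (rV_cube_sigma_finite (@lebesgue_rV_cube n)).

Lemma measurable_dotp n : measurable_fun setT (fun x : 'rV[R]_n => dotp x x).
Proof.
apply: measurable_sum => i.
by apply: measurable_funM; exact: measurable_rV_coord.
Qed.

Lemma measurable_enorm n : measurable_fun setT (@enorm n).
Proof.
apply: (measurableT_comp _ (@measurable_dotp n)).
apply: continuous_measurable_fun; exact: sqrt_continuous.
Qed.

Lemma enorm_ge0 n (x : 'rV[R]_n) : 0 <= enorm x.
Proof. exact: sqrtr_ge0. Qed.

Definition unit_dir n (x : 'rV[R]_n) : 'rV[R]_n := (enorm x)^-1 *: x.

Lemma measurable_unit_dir n : measurable_fun setT (@unit_dir n).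
Proof.
apply: measurable_fun_rV => i.
rewrite (_ : _ \o _ = fun x => (enorm x `^ (-1)) * x ord0 i); last first.
  apply/funext => x; rewrite /rV_coord /unit_dir /= mxE.
  by rewrite powR_inv1 ?enorm_ge0.
apply: measurable_funM; last exact: measurable_rV_coord.
exact: measurableT_comp (measurable_powR _) (@measurable_enorm n).
Qed.

(* Surface measure of the unit sphere S^(n-1), as a measure on R^n: n times the
   volume of the sector { r w | 0 < r <= 1, w in A }. *)
Definition sphere_measure n (A : set 'rV[R]_n) : \bar R :=
  (n%:R%:E * lebesgue_rV [set x | (0 < enorm x <= 1)%R /\ A (unit_dir x)])%E.

Let sector_measurable n (A : set 'rV[R]_n) : measurable A ->
  measurable [set x | (0 < enorm x <= 1)%R /\ A (unit_dir x)].
Proof.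
move=> mA.
rewrite (_ : [set x | _] =
  @enorm n @^-1` [set` `]0, 1]] `&` @unit_dir n @^-1` A); last first.
  by apply/seteqP; split=> x /=; rewrite in_itv.
apply: measurableI; rewrite -[X in measurable X]setTI.
  exact: measurable_enorm.
exact: measurable_unit_dir.
Qed.

Let sphere_measure0 n : @sphere_measure n set0 = 0.
Proof.
rewrite /sphere_measure (_ : [set x | _] = set0) ?measure0 ?mule0//.
by apply/seteqP; split=> x //= -[].
Qed.

Let sphere_measure_ge0 n A : (0 <= @sphere_measure n A)%E.
Proof. by rewrite mule_ge0. Qed.

Let sphere_measure_sigma_additive n : semi_sigma_additive (@sphere_measure n).
Proof.
move=> F mF tF mUF; rewrite /sphere_measure.
rewrite [X in lebesgue_rV X](_ : _ = \bigcup_k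
    [set x | (0 < enorm x <= 1)%R /\ F k (unit_dir x)]); last first.
  by apply/seteqP; split=> [x /= [x1 [k _ Fk]]|x /= [k _ [x1 Fk]]];
    [exists k|split=> //; exists k].
under eq_fun do rewrite -ge0_sume_distrr//.
apply: cvgeZl => //; apply: measure_semi_sigma_additive.
- by move=> k; exact: sector_measurable.
- apply/trivIsetP => i j _ _ ij; apply/seteqP; split=> // x /= [[_ Fi] [_ Fj]].
  move/trivIsetP : tF => /(_ i j I I ij); rewrite -subset0; apply.
  by split; [exact: Fi|exact: Fj].
- by apply: bigcupT_measurable => k; exact: sector_measurable.
Qed.

HB.instance Definition _ n := isMeasure.Build _ _ _ (@sphere_measure n)
  (@sphere_measure0 n) (@sphere_measure_ge0 n) (@sphere_measure_sigma_additive n).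

Let sphere_measure_fin n : fin_num_fun (@sphere_measure n).
Proof.
move=> A mA; rewrite fin_numM// ge0_fin_numE//.
apply: le_lt_trans (lebesgue_rV_cube n 1).
apply: le_measure; rewrite ?inE.
- exact: sector_measurable.
- exact: measurable_rV_cube.
move=> x [/andP[_ x1] _] i; rewrite in_itv/= -ler_norml.
apply: le_trans x1; rewrite -sqrtr_sqr ler_wsqrtr// /dotp (bigD1 i)//= expr2.
by rewrite lerDl sumr_ge0// => j _; rewrite -expr2 sqr_ge0.
Qed.

HB.instance Definition _ n := Measure_isFinite.Build _ _ _ (@sphere_measure n)
  (@sphere_measure_fin n).

End euclidean.

Section cone.
Context {R : realType} {n1 n2 : nat}.
Local Notation E := 'rV[R]_(n1 + n2).

Definition quadQ (x : E) : R :=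
  \sum_(i < n1) x ord0 (lshift n2 i) ^+ 2 -
  \sum_(j < n2) x ord0 (rshift n1 j) ^+ 2.

Definition cone : set E := [set x | x != 0 /\ quadQ x = 0].

Definition cone_polar
    (p : measurableTypeR R * ('rV[R]_n1 * 'rV[R]_n2)) : E :=
  row_mx (p.1 *: p.2.1) (p.1 *: p.2.2).

(* The measure dw de on S^(n1-1) x S^(n2-1). *)
Definition spheres_measure : set ('rV[R]_n1 * 'rV[R]_n2) -> \bar R :=
  (@sphere_measure R n1 \x @sphere_measure R n2)%E.

HB.instance Definition _ := Measure.copy spheres_measure
  (@sphere_measure R n1 \x @sphere_measure R n2)%E.

Let spheres_measure_fin : fin_num_fun spheres_measure.
Proof.
move=> A mA; rewrite ge0_fin_numE//.
apply: (@le_lt_trans _ _ (spheres_measure (setT `*` setT))).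
  by apply: le_measure; rewrite ?inE// setXTT.
rewrite /spheres_measure product_measure1E//.
by rewrite lte_mul_pinfty// ?fin_num_measure// -ge0_fin_numE// fin_num_measure.
Qed.

HB.instance Definition _ := Measure_isFinite.Build _ _ _ spheres_measure
  spheres_measure_fin.

(* dmu = 1/2 r^(n-3) dr dw de at x = (r w, r e), as a measure on R^n carried by
   the cone. *)
Definition cone_measure (A : set E) : \bar R :=
  (\int[@lebesgue_measure R \x spheres_measure]_(
      p in [set p : measurableTypeR R * ('rV[R]_n1 * 'rV[R]_n2) |
            (0 < p.1)%R /\ A (cone_polar p)])
    (2^-1 * p.1 ^+ (n1 + n2 - 3))%:E)%E.

Lemma measurable_cone_polar : measurable_fun setT cone_polar.
Proof.
apply: measurable_fun_rV => k; case: (split_ordP k) => j ->.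
  rewrite (_ : _ \o _ = fun p => p.1 * rV_coord j p.2.1); last first.
    by apply/funext => p; rewrite /rV_coord /cone_polar /= row_mxEl mxE.
  apply: measurable_funM => //.
  apply: (measurableT_comp (measurable_rV_coord j)).
  exact: measurableT_comp.
rewrite (_ : _ \o _ = fun p => p.1 * rV_coord j p.2.2); last first.
  by apply/funext => p; rewrite /rV_coord /cone_polar /= row_mxEr mxE.
apply: measurable_funM => //.
apply: (measurableT_comp (measurable_rV_coord j)).
exact: measurableT_comp.
Qed.

Let polar_measurable (A : set E) : measurable A ->
  measurable [set p | (0 < p.1)%R /\ A (cone_polar p)].
Proof.
move=> mA.
rewrite (_ : [set p | _] =
    fst @^-1` [set` `]0, +oo[] `&` cone_polar @^-1` A); last first.
  by apply/seteqP; split=> p /=; rewrite in_itv/= andbT.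
apply: measurableI; rewrite -[X in measurable X]setTI.
  exact: measurable_fst.
exact: measurable_cone_polar.
Qed.

Let cone_measure0 : cone_measure set0 = 0.
Proof.
rewrite /cone_measure; set D := [set p | _].
by have -> : D = set0; [apply/seteqP; split=> x //= -[]|rewrite integral_set0].
Qed.

Let cone_measure_ge0 A : (0 <= cone_measure A)%E.
Proof.
apply: integral_ge0 => p [p0 _].
by rewrite lee_fin mulr_ge0// exprn_ge0// ltW.
Qed.

Let cone_measure_sigma_additive : semi_sigma_additive cone_measure.
Proof.
move=> F mF tF mUF.
rewrite [X in _ --> X](_ : _ = \sum_(k <oo) cone_measure (F k))%E.
  apply: is_cvg_nneseries => k _ _; exact: cone_measure_ge0.
rewrite /cone_measure -ge0_integral_bigcup.
- congr (integral _ _ _); apply/seteqP; split=> [x /= [x1 [k _ Fk]]|x /= [k _ [x1 Fk]]];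
    by [exists k|split=> //; exists k].
- by move=> k; exact: polar_measurable.
- apply/measurable_EFinP; apply: measurable_funTS.
  apply: measurable_funM => //; apply: measurable_funX; exact: measurable_fst.
- by move=> p [k _ [p0 _]]; rewrite lee_fin mulr_ge0// exprn_ge0// ltW.
- apply/trivIsetP => i j _ _ ij; apply/seteqP; split=> // x /= [[_ Fi] [_ Fj]].
  move/trivIsetP : tF => /(_ i j I I ij); rewrite -subset0; apply.
  by split; [exact: Fi|exact: Fj].
Qed.

HB.instance Definition _ := isMeasure.Build _ _ _ cone_measure
  cone_measure0 cone_measure_ge0 cone_measure_sigma_additive.

(* C^infinity on an open set: all iterated partial derivatives exist and are
   continuous there. *)
Definition smooth_on n (U : set 'rV[R]_n) (F : 'rV[R]_n -> R) : Prop :=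
  forall s : seq 'I_n,
    let G := foldr (fun i g => 'D_(delta_mx ord0 i : 'rV[R]_n) g) F s in
    forall x, U x -> {for x, continuous G} /\
      forall i, derivable G x (delta_mx ord0 i).

(* A function on the cone is a function on R^n of which only the values on the
   cone are used. *)
Definition smooth_on_cone (f : E -> R) : Prop :=
  forall x, cone x -> exists U F,
    [/\ open U, U x, smooth_on U F & forall y, cone y -> U y -> f y = F y].

(* C_0^infinity(C): smooth, and the support (closure taken in the cone, hence
   away from the vertex 0) is compact. *)
Definition test_function (f : E -> R[i]) : Prop :=
  [/\ smooth_on_cone (fun x => complex.Re (f x)),
      smooth_on_cone (fun x => complex.Im (f x)) &
      compact (cone `&` closure (cone `&` [set x | f x != 0]))].

(* g is the continuous density, on R \ {0}, of the push-forward of the (signed)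
   measure f dmu under x |-> <x, xi>; this determines g t for every t != 0. *)
Definition radon_density (f : E -> R) (xi : E) (g : R -> R) : Prop :=
  (forall t, t != 0 -> {for t, continuous g}) /\
  forall B : set (measurableTypeR R), measurable B -> ~ B 0 ->
    (\int[cone_measure]_(x in cone `&` [set x | B (dotp x xi)]) (f x)%:E =
     \int[@lebesgue_measure R]_(t in B) (g t)%:E)%E.

(* get picks the function satisfying radon_density; its value at t = 0 is
   meaningless. *)
Definition radonR (f : E -> R) (xi : E) : R -> R :=
  get (radon_density f xi).

(* Complex-valued f: the real transform extended by linearity. *)
Definition radon (f : E -> R[i]) (xi : E) (t : R) : R[i] :=
  Complex (radonR (fun x => complex.Re (f x)) xi t)
          (radonR (fun x => complex.Im (f x)) xi t).

End cone.

(* Main.v *)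
(* With h = f1 - f2, equality of the transforms at xi says that the push-forward
   of h dmu under x |-> <x, xi> vanishes off 0, so the integral of
   h(x) <x, xi>^k vanishes for every xi in C and k >= 1. Since h dmu is itself
   carried by C, this can be integrated against h(xi) dmu(xi): expanding
   <x, xi>^k in monomials leaves the sum of the squares of the moments of h dmu of
   degree k. All moments of positive degree therefore vanish, and h = 0.

   The transform is chosen by [get], so the existence of a continuous density has
   to be shown first: in polar coordinates the points r v of the ray through v
   contribute the density obtained by substituting r = t / <v, xi>, and compactness
   of the support bounds the integrand away from t = 0. *)
Require Import Defs.
From mathcomp Require Import all_boot all_order all_algebra.
From mathcomp Require Import complex.
From mathcomp Require Import all_classical all_reals all_analysis.
From mathcomp Require Import measurable_realfun.
From mathcomp Require Import ring lra.
Import Order.TTheory GRing.Theory Num.Theory.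
Import numFieldNormedType.Exports.
Set Implicit Arguments.
Unset Strict Implicit.
Unset Printing Implicit Defensive.
Local Open Scope ring_scope.
Local Open Scope classical_set_scope.

(** * Signed densities determined by their moments *)

(** This is repaired by the fact that the vertex is not in C: near a point x0 of the cone the factor
    <x, x0> is positive, and it turns every polynomial into one without constant term. Passing from
    sets [B] to powers of <x, xi> uses approximation by step functions of the power: the level
    containing 0 is the only one that is not tested, and its coefficient is 0. The localisation at
    x0 takes place on a bounded part D of the cone that exceeds the supports of both functions. It
    rests on two properties of the cone measure: bounded parts of the cone have finite measure, and
    relative neighbourhoods of points of the cone have positive measure. *)

Section bounded_multipliers.
Context d (T : measurableType d) (R : realType).
Variables (mu : {measure set T -> \bar R}) (D : set T) (mD : measurable D).
Implicit Types u p q : T -> R.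

Definition bounded_mfun_on (E : set T) p :=
  measurable_fun setT p /\ exists c : R, forall x, E x -> `|p x| <= c.

Lemma bounded_mfun_onD p q : bounded_mfun_on D p -> bounded_mfun_on D q ->
  bounded_mfun_on D (fun x => p x + q x).
Proof.
move=> [mp [b pb]] [mq [c qc]]; split; first exact: measurable_funD.
by exists (b + c) => x Dx; rewrite (le_trans (ler_normD _ _))// lerD ?pb ?qc.
Qed.

Lemma bounded_mfun_onM p q : bounded_mfun_on D p -> bounded_mfun_on D q ->
  bounded_mfun_on D (fun x => p x * q x).
Proof.
move=> [mp [b pb]] [mq [c qc]]; split; first exact: measurable_funM.
by exists (b * c) => x Dx; rewrite normrM ler_pM ?pb ?qc.
Qed.

Lemma bounded_mfun_on_cst r : bounded_mfun_on D (fun=> r).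
Proof. by split => //; exists `|r|. Qed.

Lemma bounded_mfun_on_sum (I : Type) (s : seq I) (F : I -> T -> R) :
  (forall i, bounded_mfun_on D (F i)) ->
  bounded_mfun_on D (fun x => \sum_(i <- s) F i x).
Proof.
move=> bF; elim: s => [|i s ih].
  by under eq_fun do rewrite big_nil; exact: bounded_mfun_on_cst.
by under eq_fun do rewrite big_cons; exact: bounded_mfun_onD.
Qed.

Lemma bounded_mfun_on_prod (I : Type) (s : seq I) (F : I -> T -> R) :
  (forall i, bounded_mfun_on D (F i)) ->
  bounded_mfun_on D (fun x => \prod_(i <- s) F i x).
Proof.
move=> bF; elim: s => [|i s ih].
  by under eq_fun do rewrite big_nil; exact: bounded_mfun_on_cst.
by under eq_fun do rewrite big_cons; exact: bounded_mfun_onM.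
Qed.

Lemma integrable_mul_bounded u p : mu.-integrable D (EFin \o u) ->
  bounded_mfun_on D p -> mu.-integrable D (EFin \o (fun x => u x * p x)).
Proof.
move=> iu [mp [c pc]].
rewrite (_ : _ \o _ = (EFin \o u) \* (EFin \o p))%E//.
apply: integrableMl => //; first exact: measurable_funTS.
exists c; split; first exact: num_real.
by move=> M cM x Dx; exact: le_trans (pc _ Dx) (ltW cM).
Qed.

Lemma Rintegral_sum (I : Type) (s : seq I) (F : I -> T -> R) :
  (forall i, mu.-integrable D (EFin \o F i)) ->
  \int[mu]_(x in D) (\sum_(i <- s) F i x) = \sum_(i <- s) \int[mu]_(x in D) F i x.
Proof.
move=> iF; rewrite /Rintegral.
under eq_integral do rewrite -sumEFin.
have fin i : (\int[mu]_(x in D) (F i x)%:E)%E \is a fin_num.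
  exact: (integrable_fin_num mD (iF i)).
rewrite integral_sum//.
by under eq_bigr do rewrite -(fineK (fin _)); rewrite sumEFin.
Qed.

(* The multiplier is approximated uniformly by Num.floor (N p) / N, a linear
   combination of indicators of sets p @^-1` B with B not containing 0. *)
Lemma Rintegral_mul_eq0 u p : mu.-integrable D (EFin \o u) ->
  bounded_mfun_on D p ->
  (forall B : set (measurableTypeR R), measurable B -> ~ B 0 ->
    \int[mu]_(x in D `&` p @^-1` B) u x = 0) ->
  \int[mu]_(x in D) (u x * p x) = 0.
Proof.
move=> iu bp uB; have [mp [c pc]] := bp.
pose U := \int[mu]_(x in D) `|u x|.
(* Rounding at scale 1 / N.+1 costs at most |u| / N.+1, so N.+1 times the integral stays below the
   fixed bound [U]; the Archimedean property then makes it 0. *)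
suff le_U (N : nat) : N.+1%:R * `|\int[mu]_(x in D) (u x * p x)| <= U.
  apply/eqP; rewrite -normr_eq0; apply/negPn/negP => I_neq0.
  have I_gt0 : 0 < `|\int[mu]_(x in D) (u x * p x)| by rewrite lt_def I_neq0/=.
  have := le_U (Num.truncn (U / `|\int[mu]_(x in D) (u x * p x)|)).
  by rewrite leNgt -ltr_pdivrMr// truncnS_gt.
pose m := (Num.truncn (N.+1%:R * c)).+1.
pose fl x : int := Num.floor (N.+1%:R * p x).
pose z (i : 'I_(m + m).+1) : int := i%:Z - m%:Z.
pose B i : set (measurableTypeR R) := [set t | Num.floor (N.+1%:R * t) = z i].
have mB i : measurable (B i).
  rewrite (_ : B i = ( *%R N.+1%:R) @^-1` `[(z i)%:~R, (z i + 1)%:~R[).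
    rewrite -[X in measurable X]setTI.
    have mul_meas := @mulrl_measurable R setT N.+1%:R.
    exact: (mul_meas measurableT _ (measurable_itv _)).
  apply/seteqP; split => t /=; rewrite in_itv/=.
    by move=> <-; rewrite floor_itv.
  by move=> /floor_def.
have flE x : D x -> (fl x)%:~R = \sum_i (z i)%:~R * \1_(p @^-1` B i) x :> R.
  move=> Dx.
  have Npm : `|N.+1%:R * p x| <= m%:R.
    rewrite normrM ger0_norm// (le_trans (ler_wpM2l _ (pc _ Dx)))//.
    exact/ltW/truncnS_gt.
  have /andP[fl1 fl2] : - m%:Z <= fl x <= m%:Z.
    move: Npm; rewrite ler_norml => /andP[h1 h2]; apply/andP; split.
      by rewrite /fl floor_ge_int// rmorphN.
    rewrite -ltzD1 /fl floor_lt_int// (le_lt_trans h2)//.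
    by rewrite rmorphD/= ltrDl.
  have kP : (absz (fl x + m%:Z)%R < (m + m).+1)%N.
    by rewrite ltnS -lez_nat gez0_abs ?PoszD ?lerD2r// -lerBlDr sub0r.
  pose k := Ordinal kP.
  have zk : z k = fl x.
    by rewrite /z /= gez0_abs ?addrK// -lerBlDr sub0r.
  rewrite (bigD1 k)//= big1 ?addr0.
    by rewrite indicE mem_set ?mulr1 ?zk//= /B/= zk.
  move=> i ik; rewrite indicE memNset ?mulr0//= /B/=.
  rewrite -/(fl x) -zk => /addIr[] ki.
  by rewrite -val_eqE/= -ki eqxx in ik.
have ifl i : mu.-integrable D (EFin \o fun x => u x * \1_(p @^-1` B i) x).
  apply: integrable_mul_bounded => //; split.
    apply: measurable_indic; rewrite -[X in measurable X]setTI.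
    exact: (mp measurableT _ (mB i)).
  by exists 1 => x _; rewrite indicE; case: (_ \in _); rewrite ?normr1 ?normr0.
have int_fl : \int[mu]_(x in D) (u x * (fl x)%:~R) = 0.
  transitivity (\int[mu]_(x in D)
      \sum_i (z i)%:~R * (u x * \1_(p @^-1` B i) x)).
    apply: eq_Rintegral => x; rewrite inE => Dx; rewrite flE// mulr_sumr.
    by apply: eq_bigr => i _; rewrite mulrCA.
  rewrite Rintegral_sum; last first.
    by move=> i; apply: (integrableZl mD (z i)%:~R (ifl i)).
  apply: big1 => i _; rewrite RintegralZl//.
  (* The level 0 is the one whose set [B i] contains 0, and there the coefficient vanishes. *)
  have [->|zi0] := eqVneq (z i) 0; first by rewrite mul0r.
  have -> : \int[mu]_(x in D) (u x * \1_(p @^-1` B i) x) =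
            \int[mu]_(x in D `&` p @^-1` B i) u x.
    rewrite Rintegral_mkcondr; apply: eq_Rintegral => x _.
    by rewrite patchE indicE; case: ifP; rewrite ?mulr1 ?mulr0.
  rewrite uB ?mulr0//= /B/= mulr0 floor0 => /esym/eqP.
  by rewrite (negbTE zi0).
have iuN : mu.-integrable D (EFin \o fun x => u x * (N.+1%:R * p x)).
  apply: integrable_mul_bounded => //.
  exact: (bounded_mfun_onM (bounded_mfun_on_cst _) bp).
have iufl : mu.-integrable D (EFin \o fun x => u x * (fl x)%:~R).
  apply: (eq_integrable mD (fun x => (\sum_i (z i)%:~R * (u x * \1_(p @^-1` B i) x))%:E)).
    move=> x; rewrite inE => Dx /=; rewrite flE// mulr_sumr.
    by congr EFin; apply: eq_bigr => i _; rewrite mulrCA.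
  under eq_fun do rewrite -sumEFin.
  apply: integrable_sum => // i _.
  by apply: (integrableZl mD (z i)%:~R (ifl i)).
have idiff : mu.-integrable D
    (EFin \o fun x => u x * (N.+1%:R * p x) - u x * (fl x)%:~R).
  exact: (integrableB mD iuN iufl).
have -> : N.+1%:R * `|\int[mu]_(x in D) (u x * p x)| =
    `|\int[mu]_(x in D) (u x * (N.+1%:R * p x) - u x * (fl x)%:~R)|.
  rewrite RintegralB// int_fl subr0 -{1}(ger0_norm (ler0n _ N.+1)) -normrM.
  rewrite -RintegralZl//; last exact: integrable_mul_bounded.
  by congr `| _ |; apply: eq_Rintegral => x _; rewrite mulrCA.
apply: (le_trans (le_normr_Rintegral mD idiff)).
apply: le_Rintegral => //.
- exact: integrable_norm idiff.
- exact: integrable_norm iu.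
- move=> x Dx; rewrite -mulrBr normrM ler_piMr//.
  have /andP[h1 h2] := floor_itv (N.+1%:R * p x).
  rewrite ger0_norm ?subr_ge0// lerBlDr addrC ltW//.
  by rewrite rmorphD/= in h2.
Qed.

End bounded_multipliers.

Section sqdist.
Context (R : realType) (n : nat).
Implicit Types x y : 'rV[R]_n.

(** Squared, hence a polynomial in the coordinates: the vanishing of moments then applies to the
    powers of [L - sqdist x0 x]. *)
Definition sqdist x y := dotp (y - x) (y - x).

Lemma dotp_ge0 x : 0 <= dotp x x.
Proof. by apply: sumr_ge0 => i _; rewrite -expr2 sqr_ge0. Qed.

Lemma dotp_eq0 x : (dotp x x == 0) = (x == 0).
Proof.
apply/idP/eqP => [|->]; last first.
  by rewrite /dotp big1// => i _; rewrite mxE mul0r.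
rewrite psumr_eq0; last by move=> i _; rewrite -expr2 sqr_ge0.
move=> /allP x0; apply/rowP => i; rewrite mxE; apply/eqP.
by have := x0 i (mem_index_enum i); rewrite /= mulf_eq0 orbb.
Qed.

Lemma dotpE x y : 2 * dotp x y = dotp x x + dotp y y - sqdist x y.
Proof.
rewrite /sqdist /dotp mulr_sumr -big_split -sumrB.
by apply: eq_bigr => i _; rewrite !mxE /=; ring.
Qed.

Lemma measurable_sqdist x : measurable_fun setT (sqdist x).
Proof.
rewrite (_ : sqdist x = fun y => \sum_i (rV_coord i y - x ord0 i) ^+ 2).
  apply: measurable_sum => i; apply: measurable_funX.
  by apply: measurable_funB => //; exact: measurable_rV_coord.
by apply/funext => y; apply: eq_bigr => i _; rewrite !mxE expr2.
Qed.

Lemma measurable_sqball x r : measurable [set y | sqdist x y <= r].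
Proof.
rewrite (_ : [set _ | _] = sqdist x @^-1` `]-oo, r]).
  rewrite -[X in measurable X]setTI.
  by apply: measurable_sqdist => //; exact: measurable_itv.
by apply/seteqP; split => y; rewrite /= in_itv.
Qed.

End sqdist.

(** * Vanishing moments and localisation at a point *)

Section moments.
Context (R : realType) (n : nat).
Variables (mu : {measure set 'rV[R]_n -> \bar R}) (D : set 'rV[R]_n).
Hypotheses (mD : measurable D) (muD : (mu D < +oo)%E).
Hypothesis bD : forall i, bounded_mfun_on D (fun x : 'rV[R]_n => x ord0 i).
Variable u : 'rV[R]_n -> R.
Hypothesis bu : bounded_mfun_on D u.
Hypothesis u0 : forall xi, D xi -> forall B : set (measurableTypeR R),
  measurable B -> ~ B 0 ->
  \int[mu]_(x in D `&` [set x | B (dotp x xi)]) u x = 0.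

Lemma bounded_mfun_on_integrable (p : 'rV[R]_n -> R) :
  bounded_mfun_on D p -> mu.-integrable D (EFin \o p).
Proof.
move=> [mp [c pc]]; apply: measurable_bounded_integrable => //.
  exact: measurable_funTS.
exists c; split; first exact: num_real.
by move=> M cM x Dx; exact: le_trans (pc _ Dx) (ltW cM).
Qed.

Let iu : mu.-integrable D (EFin \o u).
Proof. exact: bounded_mfun_on_integrable. Qed.

(* The kernel [dotp x xi ^+ k] is positive semidefinite: it is the sum over I of
   x_I xi_I for the monomials x_I of degree k. Integrating the vanishing of the
   k-th moment in direction xi against [u xi] leaves the sum of the squares of
   the moments of degree k. *)
Lemma moment_eq0 (s : seq 'I_n) : (0 < size s)%N ->
  \int[mu]_(x in D) (u x * \prod_(i <- s) x ord0 i) = 0.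
Proof.
set k := size s => k_gt0.
(* Monomials are indexed by words of length k instead of multi-indices; each ordering is counted
   separately, so [dotpX] has no multinomial coefficients. *)
pose mon (I : {ffun 'I_k -> 'I_n}) (x : 'rV[R]_n) := \prod_j x ord0 (I j).
pose M I := \int[mu]_(x in D) (u x * mon I x).
have bmon I : bounded_mfun_on D (mon I) by exact: bounded_mfun_on_prod.
have iM I : mu.-integrable D (EFin \o fun x => u x * mon I x).
  exact: integrable_mul_bounded.
have dotpX x xi : dotp x xi ^+ k = \sum_I mon I x * mon I xi.
  rewrite /dotp -[in LHS](card_ord k) -prodr_const bigA_distr_bigA/=.
  by apply: eq_bigr => I _; rewrite big_split.
have sumM0 xi : D xi -> \sum_I M I * mon I xi = 0.
  move=> Dxi.
  rewrite -[RHS](@Rintegral_mul_eq0 _ _ _ mu D mD u (fun x => dotp x xi ^+ k) iu).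
  - under [RHS]eq_Rintegral do rewrite dotpX mulr_sumr.
    rewrite Rintegral_sum//.
      apply: eq_bigr => I _; rewrite /M -RintegralZr//.
      by apply: eq_Rintegral => x _; rewrite mulrA.
    move=> I; apply: integrable_mul_bounded => //; apply: bounded_mfun_onM => //.
    exact: bounded_mfun_on_cst.
  - under eq_fun do rewrite dotpX; apply: bounded_mfun_on_sum => I.
    apply: bounded_mfun_onM => //; exact: bounded_mfun_on_cst.
  (* The preimage of [B] under the k-th power avoids 0 because k > 0 makes [0 ^+ k] equal to 0; this
     is where degree 0 is lost. *)
  - move=> B mB B0.
    apply: (u0 Dxi (B := (fun t : R => t ^+ k) @^-1` B)); last first.
      by rewrite /= expr0n eqn0Ngt k_gt0.
    rewrite -[X in measurable X]setTI.
    exact: (@exprn_measurable R setT k measurableT _ mB).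
have /psumr_eq0P M0 : \sum_I M I ^+ 2 = 0.
  transitivity (\int[mu]_(x in D) (\sum_I M I * (u x * mon I x))).
    rewrite Rintegral_sum//.
      by apply: eq_bigr => I _; rewrite RintegralZl// expr2.
    by move=> I; apply: (integrableZl mD (M I) (iM I)).
  transitivity (\int[mu]_(x in D) (0 : R)); last first.
    by rewrite Rintegral_cst// mul0r.
  apply: eq_Rintegral => x; rewrite inE => Dx.
  under eq_bigr do rewrite mulrCA.
  by rewrite -mulr_sumr sumM0// mulr0.
transitivity (M [ffun j => tnth (in_tuple s) j]).
  apply: eq_Rintegral => x _; congr (_ * _).
  by rewrite big_tnth; apply: eq_bigr => j _; rewrite ffunE.
by apply/eqP; rewrite -sqrf_eq0 M0// => I _; exact: sqr_ge0.
Qed.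

(** The monomial of positive degree is built into the condition, so that the class contains the
    constant 1, although the integral of [u] itself is unknown, and is stable under multiplication
    by coordinates. *)
Let annih (p : 'rV[R]_n -> R) := bounded_mfun_on D p /\
  forall s : seq 'I_n, (0 < size s)%N ->
    \int[mu]_(x in D) (u x * (\prod_(i <- s) x ord0 i * p x)) = 0.

Let bmons (s : seq 'I_n) (p : 'rV[R]_n -> R) : bounded_mfun_on D p ->
  bounded_mfun_on D (fun x : 'rV[R]_n => \prod_(i <- s) x ord0 i * p x).
Proof. by move=> bp; apply: bounded_mfun_onM => //; exact: bounded_mfun_on_prod. Qed.

Let annih1 : annih (fun=> 1).
Proof.
split; first exact: bounded_mfun_on_cst.
by move=> s s0; under eq_Rintegral do rewrite mulr1; exact: moment_eq0.
Qed.

Let annihX i p : annih p -> annih (fun x => x ord0 i * p x).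
Proof.
move=> [bp p0]; split; first exact: bounded_mfun_onM.
move=> s _; rewrite -[RHS](p0 (i :: s))//.
by apply: eq_Rintegral => x _; rewrite big_cons; ring.
Qed.

Let annihD p q : annih p -> annih q -> annih (fun x => p x + q x).
Proof.
move=> [bp p0] [bq q0]; split; first exact: bounded_mfun_onD.
move=> s s0; under eq_Rintegral do rewrite 2!mulrDr.
by rewrite RintegralD ?p0 ?q0 ?addr0//; apply: integrable_mul_bounded => //; exact: bmons.
Qed.

Let annihZ c p : annih p -> annih (fun x => c * p x).
Proof.
move=> [bp p0]; split; first by apply: bounded_mfun_onM => //; exact: bounded_mfun_on_cst.
move=> s s0; rewrite (_ : Rintegral _ _ _ = \int[mu]_(x in D)
    (c * (u x * (\prod_(i <- s) x ord0 i * p x)))).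
  rewrite RintegralZl ?p0 ?mulr0//.
  by apply: integrable_mul_bounded => //; exact: bmons.
by apply: eq_Rintegral => x _; ring.
Qed.

Let annih_sum (I : Type) (s : seq I) (F : I -> 'rV[R]_n -> R) :
  (forall i, annih (F i)) -> annih (fun x => \sum_(i <- s) F i x).
Proof.
move=> aF; elim: s => [|i s ih].
  rewrite (_ : (fun _ => _) = (fun x => 0 * 1)); first exact: annihZ.
  by apply/funext => x; rewrite big_nil mul0r.
by under eq_fun do rewrite big_cons; exact: annihD.
Qed.

Let kernel (L : R) (x0 x : 'rV[R]_n) := L - sqdist x0 x.

Let annih_kernel L x0 N : annih (fun x => kernel L x0 x ^+ N).
Proof.
elim: N => [|N ih]; first by under eq_fun do rewrite expr0; exact: annih1.
rewrite (_ : (fun _ => _) = fun x => L * kernel L x0 x ^+ N + \sum_i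
   (-1 * (x ord0 i * (x ord0 i * kernel L x0 x ^+ N)) +
   (2 * x0 ord0 i * (x ord0 i * kernel L x0 x ^+ N) +
    - (x0 ord0 i ^+ 2) * kernel L x0 x ^+ N))).
  apply: annihD; first exact: annihZ.
  apply: annih_sum => i; apply: annihD; first by apply: annihZ; do 2 apply: annihX.
  by apply: annihD; apply: annihZ => //; exact: annihX.
apply/funext => x; rewrite exprS {1}/kernel mulrBl -mulNr; congr (_ + _).
rewrite /sqdist /dotp -sumrN mulr_suml; apply: eq_bigr => i _.
by rewrite !mxE; ring.
Qed.

(* A continuous density with vanishing moments of positive degree vanishes:
   otherwise the Landau kernels (L - |x - x0|^2)^N, which peak at x0, would pick
   it up. With the factor [dotp x x0], only moments of positive degree enter. *)
Lemma eq0_of_projections (x0 : 'rV[R]_n) : D x0 -> x0 != 0 ->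
  (forall e, 0 < e -> exists2 r, 0 < r & forall x, D x -> sqdist x0 x <= r ->
    `|u x - u x0| <= e) ->
  (forall r : R, (0 < r)%R -> 0 < mu (D `&` [set x | (sqdist x0 x <= r)%R]))%E ->
  u x0 = 0.
Proof.
move=> Dx0 x0_neq0 cu mu_gt0; apply/eqP/negPn/negP => ux0.
have [r1 r1_gt0 ur1] : exists2 r, 0 < r & forall x, D x -> sqdist x0 x <= r ->
    `|u x - u x0| <= `|u x0| / 2 by apply: cu; rewrite divr_gt0// normr_gt0.
have N0_gt0 : 0 < dotp x0 x0 by rewrite lt_def dotp_eq0 x0_neq0 dotp_ge0.
(* Within squared distance [r] of x0, [u] differs from [u x0] by at most half of [|u x0|], and by
   polarisation [dotp x x0] is at least [dotp x0 x0 / 4]. The factor [u x0] in [w] fixes the sign,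
   and [c] is the resulting lower bound of [w]. *)
pose r := Num.min r1 (dotp x0 x0 / 2).
have r_gt0 : 0 < r by rewrite lt_min r1_gt0 divr_gt0.
pose w x := u x0 * (u x * dotp x x0).
pose c := (u x0 ^+ 2 / 2) * (dotp x0 x0 / 4).
have u2_gt0 : 0 < u x0 ^+ 2 by rewrite lt_def sqrf_eq0 ux0 sqr_ge0.
have c_gt0 : 0 < c by rewrite mulr_gt0// divr_gt0.
have w_ge x : D x -> sqdist x0 x <= r -> c <= w x.
  rewrite le_min => Dx /andP[/(ur1 _ Dx) h1 h2].
  rewrite /w mulrA ler_pM//; [by rewrite divr_ge0// ltW|by rewrite divr_ge0// ltW| |].
    have : `|u x0 * (u x - u x0)| <= u x0 ^+ 2 / 2.
      rewrite normrM (le_trans (ler_wpM2l _ h1))//.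
      by rewrite mulrA -normrM -expr2 ger0_norm// ltW.
    by rewrite ler_norml => /andP[h3 _]; lra.
  have := dotpE x0 x; have := dotp_ge0 x.
  have -> : dotp x0 x = dotp x x0 by apply: eq_bigr => i _; rewrite mulrC.
  by lra.
have bdot : bounded_mfun_on D (fun x => dotp x x0).
  apply: bounded_mfun_on_sum => i; apply: bounded_mfun_onM => //.
  exact: bounded_mfun_on_cst.
have bw : bounded_mfun_on D w.
  apply: bounded_mfun_onM; first exact: bounded_mfun_on_cst.
  exact: bounded_mfun_onM.
have [_ [K wK]] := bw.
have K_ge0 : 0 <= K by rewrite (le_trans _ (wK _ Dx0)).
have bsq : bounded_mfun_on D (sqdist x0).
  rewrite (_ : sqdist x0 =
     fun x => \sum_i ((x ord0 i + - x0 ord0 i) * (x ord0 i + - x0 ord0 i))).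
    apply: bounded_mfun_on_sum => i.
    by apply: bounded_mfun_onM; apply: bounded_mfun_onD => //; exact: bounded_mfun_on_cst.
  by apply/funext => x; apply: eq_bigr => i _; rewrite !mxE.
have [_ [L0 sqL0]] := bsq.
(* With [L0] bounding the squared distance on [D], the kernel is nonnegative on [D], [L - r] is
   still nonnegative and [L - r / 2] is positive. *)
pose L := L0 + r.
have sqL x : D x -> sqdist x0 x <= L.
  by move=> Dx; have := sqL0 _ Dx; rewrite ger0_norm ?dotp_ge0// /L; lra.
have L0_ge0 : 0 <= L0 by rewrite (le_trans _ (sqL0 _ Dx0)).
pose A := D `&` [set x | sqdist x0 x <= r / 2].
have mA : measurable A by apply: measurableI => //; exact: measurable_sqball.
have muA : (mu A < +oo)%E.
  apply: (le_lt_trans _ muD); apply: (@le_measure _ _ _ mu); rewrite ?inE//.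
  exact: subIsetl.
have muA_gt0 : 0 < fine (mu A).
  by rewrite fine_gt0// muA andbT; apply: mu_gt0; rewrite divr_gt0.
(* The integral of [w] times the N-th power of the kernel is 0. On [A] the integrand is at least c
   (L - r / 2)^N, on the rest of the ball of squared radius r it is nonnegative, and elsewhere it is
   at least -K (L - r)^N. *)
have key N : c * (L - r / 2) ^+ N * fine (mu A) <= K * (L - r) ^+ N * fine (mu D).
  rewrite -subr_le0.
  have bwk : bounded_mfun_on D (fun x => w x * kernel L x0 x ^+ N).
    by apply: bounded_mfun_onM => //; case: (annih_kernel L x0 N).
  have bind : bounded_mfun_on D (fun x => (c * (L - r / 2) ^+ N) * \1_A x).
    apply: bounded_mfun_onM; first exact: bounded_mfun_on_cst.
    split; first exact: measurable_indic.
    by exists 1 => x _; rewrite indicE; case: (_ \in _); rewrite ?normr1 ?normr0.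
  (* Expanding [dotp x x0] in [w] supplies the monomial of degree 1 that [annih] asks for. *)
  have <- : \int[mu]_(x in D) (w x * kernel L x0 x ^+ N) = 0.
    transitivity (\int[mu]_(x in D) (\sum_i (u x0 * x0 ord0 i) *
        (u x * (\prod_(j <- [:: i]) x ord0 j * kernel L x0 x ^+ N)))).
      apply: eq_Rintegral => x _; rewrite /w /dotp.
      rewrite !(mulr_sumr, mulr_suml); apply: eq_bigr => i _.
      by rewrite big_seq1; ring.
    have [bk k0] := annih_kernel L x0 N.
    have ik i : mu.-integrable D (EFin \o fun x =>
        u x * (\prod_(j <- [:: i]) x ord0 j * kernel L x0 x ^+ N)).
      by apply: integrable_mul_bounded => //; exact: bmons.
    rewrite Rintegral_sum//; last by move=> i; exact: (integrableZl mD _ (ik i)).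
    by apply: big1 => i _; rewrite RintegralZl// k0// mulr0.
  have -> : c * (L - r / 2) ^+ N * fine (mu A) - K * (L - r) ^+ N * fine (mu D) =
      \int[mu]_(x in D) ((c * (L - r / 2) ^+ N) * \1_A x - K * (L - r) ^+ N).
    rewrite RintegralB//; [|exact: bounded_mfun_on_integrable|].
      rewrite Rintegral_cst// RintegralZl//; last first.
        apply: bounded_mfun_on_integrable; split; first exact: measurable_indic.
        by exists 1 => x _; rewrite indicE; case: (_ \in _); rewrite ?normr1 ?normr0.
      rewrite /Rintegral integral_indic// setIidl//; exact: subIsetl.
    exact/bounded_mfun_on_integrable/bounded_mfun_on_cst.
  apply: le_Rintegral => //.
  - apply: bounded_mfun_on_integrable.
    apply: (bounded_mfun_onD bind (bounded_mfun_on_cst _ _)).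
  - exact: bounded_mfun_on_integrable.
  move=> x Dx; have k_ge0 : 0 <= kernel L x0 x by rewrite subr_ge0 sqL.
  have Lr : 0 <= L - r by rewrite /L addrK.
  have KLr : 0 <= K * (L - r) ^+ N by rewrite mulr_ge0// exprn_ge0.
  have [xr|xr] := leP (sqdist x0 x) r.
    have wx := w_ge _ Dx xr.
    apply: (@le_trans _ _ (c * kernel L x0 x ^+ N)); last first.
      by rewrite ler_wpM2r// exprn_ge0.
    rewrite indicE; have [xA|xA] := boolP (x \in A).
      rewrite mulr1; move: xA; rewrite inE => -[_ /= xA].
      rewrite lerBlDr ler_wpDr// ler_wpM2l ?(ltW c_gt0)// lerXn2r ?nnegrE//.
        by lra.
      by rewrite /kernel lerB.
    by rewrite mulr0 sub0r (le_trans (y := 0)) ?oppr_le0// mulr_ge0 ?(ltW c_gt0)// exprn_ge0.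
  rewrite indicE memNset ?mulr0 ?sub0r; last first.
    by move=> [_ /= xA]; move: xr; rewrite ltNge (le_trans xA)//; lra.
  have := wK _ Dx; rewrite ler_norml => /andP[wx _].
  apply: (@le_trans _ _ (- K * kernel L x0 x ^+ N)); last by rewrite ler_wpM2r// exprn_ge0.
  rewrite mulNr lerN2 ler_wpM2l// lerXn2r ?nnegrE//.
  by rewrite /kernel lerB// ltW.
have q1_gt0 : 0 < L - r / 2 by rewrite /L; lra.
pose z := (L - r) / (L - r / 2).
have z_lt1 : `|z| < 1.
  rewrite ger0_norm; first by rewrite ltr_pdivrMr// mul1r; lra.
  by rewrite divr_ge0 ?(ltW q1_gt0)// /L addrK.
have key' N : c * fine (mu A) <= K * fine (mu D) * z ^+ N.
  rewrite -(ler_pM2r (exprn_gt0 N q1_gt0)) -[leRHS]mulrA -exprMn divfK ?gt_eqF//.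
  by rewrite mulrAC [leRHS]mulrAC; exact: key.
have := c_gt0; rewrite -(pmulr_lgt0 _ muA_gt0) => cA_gt0.
have : c * fine (mu A) <= 0.
  have /cvg_lim <-// : K * fine (mu D) * z ^+ N @[N --> \oo] --> (0 : R).
    rewrite -[X in _ --> X](mulr0 (K * fine (mu D))).
    by apply: cvgMr; exact: cvg_expr.
  apply: limr_ge; last by apply: nearW => N; exact: key'.
  by apply: is_cvgMr; apply: cvgP; exact: cvg_expr.
by rewrite leNgt cA_gt0.
Qed.

End moments.

(** * Change of variables *)

Section ge0_transfer_density.
Local Open Scope ereal_scope.
Context d1 d2 (X : measurableType d1) (Y : measurableType d2) (R : realType).
Variables (mu : {measure set X -> \bar R}) (nu : {measure set Y -> \bar R}).
Variables (phi : X -> Y) (mphi : measurable_fun setT phi).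
Variables (D : set X) (mD : measurable D).
Variables (w : X -> R) (mw : measurable_fun setT w).
Hypothesis w0 : forall x, D x -> (0 <= w x)%R.
Hypothesis nuE : forall A, measurable A ->
  nu A = \int[mu]_(x in D `&` phi @^-1` A) (w x)%:E.

Import HBNNSimple.

(** Reduces a change of variables to the measures of sets, by simple functions and monotone
    convergence. It serves both the scaling of the line and the polar coordinates on the cone. *)
Lemma ge0_integral_density (f : Y -> \bar R) : measurable_fun setT f ->
  (forall y, 0 <= f y) ->
  \int[nu]_y f y = \int[mu]_(x in D) (f (phi x) * (w x)%:E).
Proof.
move=> mf f0; pose f_ := nnsfun_approx measurableT mf.
have mfw n : measurable_fun D (fun x => (f_ n (phi x))%:E * (w x)%:E).
  apply/measurable_EFinP; apply: measurable_funM; apply: measurable_funTS => //.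
  by apply: measurableT_comp mphi.
transitivity (limn (fun n => \int[nu]_y (f_ n y)%:E)).
  rewrite -monotone_convergence//.
  - by apply: eq_integral => y _; apply/esym/cvg_lim => //; exact: cvg_nnsfun_approx.
  - by move=> n; exact/measurable_EFinP/measurable_funP.
  - by move=> n y _; rewrite lee_fin.
  - by move=> y _ m n mn; rewrite lee_fin; exact/lefP/nd_nnsfun_approx.
transitivity (limn (fun n => \int[mu]_(x in D) ((f_ n (phi x))%:E * (w x)%:E))).
  congr (limn _); apply/funext => n.
  have mB r : measurable (f_ n @^-1` [set r]) by [].
  rewrite integralT_nnsfun sintegralE.
  transitivity (\sum_(r \in range (f_ n))
      \int[mu]_(x in D) (r%:E * (\1_(f_ n @^-1` [set r]) (phi x) * w x)%:E)).
    apply: eq_fsbigr => r /[!inE] -[y _ fry].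
    have r0 : (0 <= r)%R by rewrite -fry.
    rewrite ge0_integralZl//.
    - congr (_ * _); rewrite nuE// integral_mkcondr.
      apply: eq_integral => x _; rewrite patchE indicE.
      rewrite -[x \in _]/(phi x \in f_ n @^-1` [set r]).
      by case: (_ \in _); rewrite ?mul1r ?mul0r.
    - apply/measurable_EFinP; apply: measurable_funM; apply: measurable_funTS => //.
      by apply: measurableT_comp mphi; exact: measurable_indic.
    - by move=> x Dx; rewrite lee_fin mulr_ge0// w0.
  rewrite -ge0_integral_fsum//.
  - apply: eq_integral => x _; rewrite [in RHS]fimfunE -fsumEFin// ge0_mule_fsuml.
      by apply: eq_fsbigr => r _; rewrite !EFinM muleA.
    by move=> r; rewrite nnfun_muleindic_ge0.
  - move=> r; apply: measurable_funeM; apply/measurable_EFinP.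
    apply: measurable_funM; apply: measurable_funTS => //.
    by apply: measurableT_comp mphi; exact: measurable_indic.
  - move=> r x Dx; rewrite EFinM muleA mule_ge0 ?nnfun_muleindic_ge0//.
    by rewrite lee_fin w0.
rewrite -monotone_convergence//.
- apply: eq_integral => x _; apply/cvg_lim => //.
  by apply: cvgeZr => //; exact: cvg_nnsfun_approx.
- by move=> n x Dx; rewrite mule_ge0// lee_fin// w0.
- move=> x Dx m n mn; rewrite lee_wpmul2r ?lee_fin ?w0//.
  exact/lefP/nd_nnsfun_approx.
Qed.

End ge0_transfer_density.

Section lebesgue_scaling.
Context (R : realType).
Local Notation lambda := (@lebesgue_measure R).

(** By uniqueness of Lebesgue measure it suffices to compare on half-open intervals; for negative
    [p] the preimage is half-open at the other end. *)
Lemma lebesgue_measure_scale (p : R) (A : set (measurableTypeR R)) :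
  p != 0 -> measurable A ->
  lambda A = (`|p|^-1%:E * lambda [set t | A (t / p)%R])%E.
Proof.
move=> p_neq0 mA.
pose phi (t : measurableTypeR R) : measurableTypeR R := t / p.
have mphi : measurable_fun setT phi by exact: mulrr_measurable.
have pV_ge0 : 0 <= `|p|^-1 by rewrite invr_ge0.
pose nu := mscale (NngNum pV_ge0)
  (measure_function_pushforward__canonical__measure_function_Measure
     lambda mphi).
suff H X : ocitv X -> lambda X = nu X by exact: (lebesgue_measure_unique H).
move=> [[a b]] _ <- /=.
rewrite /nu /mscale /= /pushforward.
have pV : `|p|^-1 * `|p| = 1 by rewrite mulVf// normr_eq0.
have [p_gt0|p_le0] := ltP 0 p.
  rewrite (_ : phi @^-1` _ = `]a * p, b * p]%classic); last first.
    by apply/seteqP; split => t; rewrite /phi /= !in_itv/= ltr_pdivlMr// ler_pdivrMr.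
  rewrite !lebesgue_measure_itv /= !lte_fin ltr_pM2r//.
  case: ifP => _; last by rewrite mule0.
  by rewrite -!EFinB -EFinM -mulrBl gtr0_norm// mulrCA mulVf ?mulr1.
have p_lt0 : p < 0 by rewrite lt_neqAle p_neq0.
rewrite (_ : phi @^-1` _ = `[b * p, a * p[%classic); last first.
  apply/seteqP; split => t; rewrite /phi /= !in_itv/= andbC.
    by rewrite ltr_ndivlMr// ler_ndivrMr.
  by rewrite ltr_ndivlMr// ler_ndivrMr.
rewrite !lebesgue_measure_itv /= !lte_fin ltr_nM2r//.
case: ifP => _; last by rewrite mule0.
rewrite -!EFinB -EFinM -mulrBl ltr0_norm// invrN mulNr -mulrN -mulNr opprB.
by rewrite mulrCA mulVf ?mulr1.
Qed.

Lemma ge0_integral_scale (p : R) (f : measurableTypeR R -> \bar R) : p != 0 ->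
  measurable_fun setT f -> (forall r, 0 <= f r)%E ->
  (\int[lambda]_r f r = \int[lambda]_t (f (t / p)%R * (`|p|^-1)%:E))%E.
Proof.
move=> p_neq0 mf f0.
apply: (@ge0_integral_density _ _ _ _ _ lambda lambda
  (fun t : measurableTypeR R => t / p : measurableTypeR R) _ setT measurableT
  (fun=> `|p|^-1)) => //.
- exact: mulrr_measurable.
- move=> A mA; rewrite setTI integral_cst.
    exact: lebesgue_measure_scale.
  rewrite -[X in measurable X]setTI.
  by apply: (mulrr_measurable p^-1).
Qed.

End lebesgue_scaling.

(** * Euclidean balls and Borel sets *)

Section sqdist_topology.
Context (R : realType) (n : nat).
Implicit Types (x y : 'rV[R]_n) (C W : set 'rV[R]_n) (f : 'rV[R]_n -> R).

Lemma sqdistC x y : sqdist x y = sqdist y x.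
Proof. by apply: eq_bigr => i _; rewrite !mxE; ring. Qed.

(** Substitute for the triangle inequality without square roots: coordinatewise the difference of
    the two sides is (a - 2 b + c)^2. *)
Lemma sqdist_le x y z : sqdist x z <= 2 * (sqdist x y + sqdist y z).
Proof.
rewrite /sqdist /dotp -big_split mulr_sumr/=; apply: ler_sum => i _.
rewrite !mxE; set a := x ord0 i; set b := y ord0 i; set c := z ord0 i.
by have := sqr_ge0 (a - 2 * b + c); rewrite expr2; lra.
Qed.

Lemma dotp_le x y : dotp x x <= 2 * (dotp y y + sqdist x y).
Proof.
have := sqdist_le 0 y x; rewrite /sqdist !subr0.
by rewrite -[dotp (x - y) _]/(sqdist y x) sqdistC.
Qed.

Lemma sqr_coord_le x i : x ord0 i ^+ 2 <= dotp x x.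
Proof.
by rewrite /dotp (bigD1 i)//= expr2 lerDl sumr_ge0// => j _; rewrite -expr2 sqr_ge0.
Qed.

Lemma sqdist_coord_le (e : R) x y : 0 <= e -> e <= 1 ->
  (forall i, `|y ord0 i - x ord0 i| <= e) -> sqdist x y <= n%:R * e.
Proof.
move=> e0 e1 xy; rewrite /sqdist /dotp mulr_natl -[n in leRHS]card_ord -sumr_const.
apply: ler_sum => i _; rewrite !mxE -expr2 -real_normK ?num_real// expr2.
by rewrite (le_trans (ler_pM _ _ (xy i) (le_trans (xy i) e1)))// mulr1.
Qed.

(** Together with [sqdist_nbhs], this identifies the topology of the maximum norm with the one given
    by Euclidean balls. *)
Lemma nbhs_sqdist x U : nbhs x U ->
  exists2 r, 0 < r & forall y, sqdist x y <= r -> U y.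
Proof.
move=> /nbhs_ballP[e /= e0 xU]; exists ((e / 2) ^+ 2).
  by rewrite exprn_gt0// divr_gt0.
move=> y xy; apply: xU; split=> // i j; rewrite (ord1 i).
have := le_trans (sqr_coord_le (y - x) j) xy.
rewrite -(@real_normK _ ((y - x) ord0 j)) ?num_real//.
rewrite ler_sqr ?nnegrE ?divr_ge0 ?(ltW e0)// !mxE => h.
rewrite /ball/= distrC (le_lt_trans h)//.
by rewrite ltr_pdivrMr// ltr_pMr// ltr1n.
Qed.

Lemma sqdist_nbhs x r : 0 < r -> nbhs x [set y | sqdist x y <= r].
Proof.
(* [n.+1] keeps the quotient positive also for n = 0. *)
move=> r0; pose e := Num.min 1 (r / n.+1%:R).
have e0 : 0 < e by rewrite lt_min ltr01 divr_gt0.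
apply/nbhs_ballP; exists e => //= y [_ xy] /=.
rewrite (le_trans (sqdist_coord_le (ltW e0) _ _))//.
- by rewrite ge_min lexx.
- by move=> i; have := xy ord0 i; rewrite /ball/= distrC => /ltW.
apply: (@le_trans _ _ (n.+1%:R * (r / n.+1%:R))).
  by apply: ler_pM => //; [exact: ltW|rewrite ler_nat|rewrite ge_min lexx orbT].
by rewrite mulrC divfK.
Qed.

(** Second countability: [W] is the union of the traces on [C] of those balls with rational centre
    and radius whose trace lies in [W]. It is needed because the sigma-algebra is generated by
    coordinates, not by open sets. *)
Lemma measurable_relatively_open C W : measurable C -> W `<=` C ->
  (forall x, W x -> exists2 r, 0 < r & forall y, C y -> sqdist x y <= r -> W y) ->
  measurable W.
Proof.
move=> mC WC oW.
pose c (q : 'rV[rat]_n) : 'rV[R]_n := map_mx ratr q.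
pose B (qk : 'rV[rat]_n * nat) : set 'rV[R]_n :=
  [set y | sqdist (c qk.1) y <= qk.2.+1%:R^-1].
pose F qk := if `[< C `&` B qk `<=` W >] then C `&` B qk else set0.
have -> : W = \bigcup_qk F qk.
  apply/seteqP; split => [x Wx|x [qk _]]; last first.
    by rewrite /F; case: asboolP => // CBW; exact: CBW.
  have [r r0 xW] := oW _ Wx.
  (* Two points of a ball of squared radius 1 / k.+1 are at squared distance at most 4 / k.+1 by
     [sqdist_le], which must not exceed [r]. *)
  pose k := Num.truncn (4 / r).
  have kr : 4 / k.+1%:R <= r by rewrite ler_pdivrMr// -ler_pdivrMl// mulrC ltW// truncnS_gt.
  pose e : R := (n.+1%:R * k.+1%:R)^-1.
  have e0 : 0 < e by rewrite invr_gt0 mulr_gt0.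
  have e1 : e <= 1 by rewrite invf_le1 ?mulr_gt0// -natrM ler1n.
  have hq i : exists q : rat, `|ratr q - x ord0 i| <= e.
    have : x ord0 i < x ord0 i + e by rewrite ltrDl.
    move=> /rat_in_itvoo[q]; rewrite in_itv/= => /andP[q1 q2]; exists q.
    by rewrite ger0_norm ?subr_ge0 ?(ltW q1)// lerBlDl ltW.
  have {hq}/choice[q hq] := hq.
  have xq : sqdist x (c (\row_i q i)) <= k.+1%:R^-1.
    rewrite (le_trans (sqdist_coord_le (ltW e0) e1 _))//.
      by move=> i; rewrite !mxE; exact: hq.
    by rewrite /e invfM mulrA ler_piMl ?invr_ge0// ler_pdivrMr// mul1r ler_nat.
  exists (\row_i q i, k) => //; rewrite /F asboolT.
    by split; [exact: WC|rewrite /B/= sqdistC].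
  move=> y [Cy]; rewrite /B/= => qy; apply: xW => //.
  rewrite (le_trans (sqdist_le _ (c (\row_i q i)) _))//.
  by apply: le_trans kr; move: xq qy; move: k.+1%:R^-1 => t; lra.
apply: countable_bigcupT_measurable => // qk; rewrite /F; case: ifP => // _.
by apply: measurableI => //; exact: measurable_sqball.
Qed.

Definition continuous_on C f := forall x, C x -> forall e, 0 < e ->
  exists2 r, 0 < r & forall y, C y -> sqdist x y <= r -> `|f y - f x| <= e.

Lemma continuous_on_measurable C f : measurable C -> continuous_on C f ->
  measurable_fun C f.
Proof.
move=> mC cf; move=> _; apply: (measurability _ (RGenOInfty.measurableE R)) => //.
move=> _ [_ [a ->] <-]; apply: (measurable_relatively_open mC); first exact: subIsetl.
move=> x [Cx]; rewrite /= in_itv/= andbT -subr_gt0 => fx.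
have [r r0 xr] := cf _ Cx _ (divr_gt0 fx (ltr0n _ 2)).
exists r => // y Cy xy; split => //; rewrite /= in_itv/= andbT.
by have := xr _ Cy xy; rewrite ler_norml => /andP[h _]; lra.
Qed.

Lemma compact_locally_bounded (K C : set 'rV[R]_n) f : compact K -> K `<=` C ->
  (forall x, C x -> exists2 r, 0 < r &
     exists M, forall y, C y -> sqdist x y <= r -> `|f y| <= M) ->
  exists M, forall x, K x -> `|f x| <= M.
Proof.
move=> /compact_near_coveringP cK KC bf.
have [M [_ MK]] : \forall M \near +oo, K `<=` (fun y => C y -> `|f y| <= M).
  apply: (cK R (+oo%R : set_system R) (fun M y => C y -> `|f y| <= M)).
  move=> x /KC /bf[r r0 [M xM]].
  exists ([set y | sqdist x y <= r], [set N | M < N]) => /=.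
    split; first exact: sqdist_nbhs.
    by exists M; split => //; exact: num_real.
  move=> [y N] /= [xy MN] Cy.
  by rewrite (le_trans (xM _ Cy xy))// ltW.
exists (M + 1) => x Kx; apply: (MK (M + 1)) => //; first by rewrite ltrDl.
exact: KC.
Qed.

End sqdist_topology.

(** * Polar coordinates on the cone *)

Section cone_geometry.
Context {R : realType} {n1 n2 : nat}.
Local Notation E := 'rV[R]_(n1 + n2).
Local Notation S := ('rV[R]_n1 * 'rV[R]_n2)%type.
Implicit Types (x : E) (v : S) (r : R).

Definition join_rV v : E := row_mx v.1 v.2.

Definition unit_spheres : set S := [set v | enorm v.1 = 1 /\ enorm v.2 = 1].

Lemma dotp_row_mx (a c : 'rV[R]_n1) (b d : 'rV[R]_n2) :
  dotp (row_mx a b) (row_mx c d) = dotp a c + dotp b d.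
Proof.
rewrite /dotp big_split_ord/=.
by congr (_ + _); apply: eq_bigr => i _; rewrite ?row_mxEl ?row_mxEr.
Qed.

Lemma dotpZl n r (x y : 'rV[R]_n) : dotp (r *: x) y = r * dotp x y.
Proof. by rewrite /dotp mulr_sumr; apply: eq_bigr => i _; rewrite mxE mulrA. Qed.

Lemma dotpZr n r (x y : 'rV[R]_n) : dotp x (r *: y) = r * dotp x y.
Proof. by rewrite /dotp mulr_sumr; apply: eq_bigr => i _; rewrite mxE mulrCA. Qed.

Lemma cone_polarE r v : cone_polar (r, v) = r *: join_rV v.
Proof. by rewrite /cone_polar/= scale_row_mx. Qed.

Lemma quadQE x : quadQ x = dotp (lsubmx x) (lsubmx x) - dotp (rsubmx x) (rsubmx x).
Proof. by congr (_ - _); apply: eq_bigr => i _; rewrite mxE expr2. Qed.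

Lemma enorm1_dotp n (x : 'rV[R]_n) : enorm x = 1 -> dotp x x = 1.
Proof. by move=> x1; rewrite -[RHS](expr1n _ 2) -x1 sqr_sqrtr// dotp_ge0. Qed.

Lemma dotp_polar r v : unit_spheres v ->
  dotp (r *: join_rV v) (r *: join_rV v) = 2 * r ^+ 2.
Proof.
move=> [/enorm1_dotp v1 /enorm1_dotp v2].
by rewrite dotpZl dotpZr dotp_row_mx v1 v2; ring.
Qed.

(** A crude bound that avoids the square root: if r > 1 then r <= 2 r^2 <= rho. *)
Lemma dotp_polar_le r v (rho : R) : 0 <= rho -> unit_spheres v ->
  dotp (r *: join_rV v) (r *: join_rV v) <= rho -> r <= 1 + rho.
Proof.
move=> rho0 Sv; rewrite dotp_polar// => h.
have [r1|r1] := leP r 1; first by rewrite (le_trans r1)// lerDl.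
have : r * 1 <= r * r by rewrite ler_wpM2l// ltW// (lt_trans _ r1).
by have := ltW r1; move: h; rewrite expr2; lra.
Qed.

Lemma cone_scale_unit_spheres r v : unit_spheres v -> 0 < r -> cone (r *: join_rV v).
Proof.
move=> Sv r0; split; first by rewrite -dotp_eq0 dotp_polar// mulf_neq0// sqrf_eq0 gt_eqF.
move: Sv => [/enorm1_dotp v1 /enorm1_dotp v2].
rewrite quadQE /join_rV scale_row_mx row_mxKl row_mxKr.
by rewrite !(dotpZl, dotpZr) v1 v2 subrr.
Qed.

Lemma measurable_quadQ : measurable_fun setT (@quadQ R n1 n2).
Proof.
by apply: measurable_funB; apply: measurable_sum => i; apply: measurable_funX;
  exact: measurable_rV_coord.
Qed.

Lemma measurable_cone : measurable (@cone R n1 n2).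
Proof.
rewrite (_ : cone = ~` ((fun x => dotp x x) @^-1` [set 0]) `&` quadQ @^-1` [set 0]).
  apply: measurableI; [apply: measurableC|]; rewrite -[X in measurable X]setTI.
    by apply: measurable_dotp => //; exact: measurable_set1.
  by apply: measurable_quadQ => //; exact: measurable_set1.
apply/seteqP; split => x.
  by move=> [x0 Q0]; split => //=; apply/eqP; rewrite dotp_eq0.
by move=> [/= /eqP + Q0]; rewrite dotp_eq0.
Qed.

Lemma measurable_unit_spheres : measurable unit_spheres.
Proof.
rewrite (_ : unit_spheres = (@enorm R n1 @^-1` [set 1]) `*` (@enorm R n2 @^-1` [set 1]))//.
by apply: measurableX; rewrite -[X in measurable X]setTI;
  apply: measurable_enorm => //; exact: measurable_set1.
Qed.

Lemma enorm_unit_dir n (x : 'rV[R]_n) : 0 < enorm x -> enorm (unit_dir x) = 1.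
Proof.
move=> x0; rewrite /unit_dir {1}/enorm dotpZl dotpZr mulrA -expr2.
rewrite sqrtrM ?sqr_ge0// sqrtr_sqr ger0_norm ?invr_ge0 ?enorm_ge0//.
by rewrite -/(enorm x) mulVf// gt_eqF.
Qed.

Lemma sphere_measure_setC n : sphere_measure [set x : 'rV[R]_n | enorm x != 1] = 0.
Proof.
rewrite /sphere_measure (_ : [set x | _] = set0) ?measure0 ?mule0//.
apply/seteqP; split => // x /= [/andP[x0 _]] /eqP; apply.
exact: enorm_unit_dir.
Qed.

(** The sphere measures live on the ambient spaces, so that polar integrals a priori run over all
    pairs of vectors; this allows them to be restricted to unit vectors, where the norm and cone
    identities hold. *)
Lemma spheres_measure_setC : @spheres_measure R n1 n2 (~` unit_spheres) = 0.
Proof.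
have m1 n : measurable [set x : 'rV[R]_n | enorm x != 1].
  rewrite (_ : [set x | _] = ~` (@enorm R n @^-1` [set 1])).
    apply: measurableC; rewrite -[X in measurable X]setTI.
    by apply: measurable_enorm => //; exact: measurable_set1.
  by apply/seteqP; split => x /= /eqP.
have null1 : @spheres_measure R n1 n2 ([set x | enorm x != 1] `*` setT) = 0.
  transitivity (sphere_measure [set x : 'rV[R]_n1 | (enorm x != 1)%R] *
      sphere_measure [set: 'rV[R]_n2])%E; first exact: (product_measure1E _ _ (m1 n1) measurableT).
  by rewrite sphere_measure_setC mul0e.
have null2 : @spheres_measure R n1 n2 (setT `*` [set x | enorm x != 1]) = 0.
  transitivity (sphere_measure [set: 'rV[R]_n1] *
      sphere_measure [set x : 'rV[R]_n2 | (enorm x != 1)%R])%E.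
    exact: (product_measure1E _ _ measurableT (m1 n2)).
  by rewrite sphere_measure_setC mule0.
rewrite (_ : ~` _ = ([set x : 'rV[R]_n1 | enorm x != 1] `*` setT) `|`
                    (setT `*` [set x : 'rV[R]_n2 | enorm x != 1])).
  by rewrite measureU0; [exact: null1|exact: measurableX|exact: measurableX|exact: null2].
apply/seteqP; split => -[a b] /=.
  by move/not_andP => [/eqP|/eqP] h; [left|right].
by move=> [[/eqP h _]|[_ /eqP h]] [? ?].
Qed.

Lemma measurable_join_rV : measurable_fun setT join_rV.
Proof.
rewrite (_ : join_rV = cone_polar \o (fun v => (1, v))).
  by apply: measurableT_comp; [exact: measurable_cone_polar|exact: measurable_pair1].
by apply/funext => v /=; rewrite cone_polarE scale1r.
Qed.

Lemma ge0_integral_cone (F : E -> \bar R) : measurable_fun setT F ->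
  (forall x, 0 <= F x)%E ->
  (\int[cone_measure]_x F x = \int[@spheres_measure R n1 n2]_(v in unit_spheres)
     \int[lebesgue_measure]_(r in `]0%R, +oo[)
        (F (r *: join_rV v) * (2^-1 * r ^+ (n1 + n2 - 3))%:E))%E.
Proof.
move=> mF F0.
pose D : set (measurableTypeR R * S) := [set p | 0 < p.1].
have mD : measurable D.
  rewrite (_ : D = fst @^-1` `]0, +oo[).
    rewrite -[X in measurable X]setTI.
    by apply: measurable_fst => //; exact: measurable_itv.
  by apply/seteqP; split => p; rewrite /= in_itv/= andbT.
pose w (p : measurableTypeR R * S) := 2^-1 * p.1 ^+ (n1 + n2 - 3).
have mw : measurable_fun setT w.
  by apply: measurable_funM => //; apply: measurable_funX; exact: measurable_fst.
have w0 p : D p -> 0 <= w p by move=> Dp; rewrite mulr_ge0// exprn_ge0// ltW.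
pose H p := (F (cone_polar p) * (w p)%:E)%E.
have mH : measurable_fun setT H.
  apply: emeasurable_funM; last exact/measurable_EFinP.
  by apply: measurableT_comp => //; exact: measurable_cone_polar.
have mHD : measurable_fun setT (H \_ D).
  exact: ((measurable_restrictT H mD).1 (measurable_funTS mH)).
have HD0 p : (0 <= (H \_ D) p)%E.
  rewrite patchE; case: ifP => // /set_mem Dp.
  by rewrite mule_ge0// lee_fin w0.
rewrite (@ge0_integral_density _ _ _ _ _
  (@lebesgue_measure R \x @spheres_measure R n1 n2)%E cone_measure _
  (@measurable_cone_polar R n1 n2) D mD w mw w0 _ F mF F0)//.
rewrite integral_mkcond -/H fubini_tonelli2//.
rewrite (ge0_negligible_integral (N := ~` unit_spheres))//.
- rewrite setDE setCK setTI; apply: eq_integral => v _.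
  rewrite /fubini_G [RHS]integral_mkcond; apply: eq_integral => r _.
  rewrite !patchE /H /w cone_polarE/=.
  rewrite -(_ : ((r, v) \in D) = (r \in `]0, +oo[%classic))//.
  by apply/idP/idP; rewrite !inE/= in_itv/= andbT.
- by apply: measurableC; exact: measurable_unit_spheres.
- exact: measurable_fun_fubini_tonelli_G.
- by move=> v _; apply: integral_ge0.
- exact: spheres_measure_setC.
Qed.

End cone_geometry.

Lemma measurable_invr (R : realType) :
  measurable_fun [set: measurableTypeR R] (GRing.inv : R -> R).
Proof.
(* [powR_inv1] wants a nonnegative base, hence the square; at 0 both sides are 0. *)
rewrite (_ : GRing.inv = fun x : R => x * (x ^+ 2) `^ (-1)).
  apply: measurable_funM => //.
  by apply: (measurableT_comp (measurable_powR _)); exact: exprn_measurable.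
apply/funext => x; rewrite powR_inv1 ?sqr_ge0//.
by have [->|x0] := eqVneq x 0; [rewrite invr0 mul0r|rewrite expr2 invfM mulrA mulfV// mul1r].
Qed.

(** * Density of the push-forward, ray by ray *)

Section radial_density.
Context {R : realType} {n1 n2 : nat}.
Local Notation E := 'rV[R]_(n1 + n2).
Local Notation S := ('rV[R]_n1 * 'rV[R]_n2)%type.
Local Notation lambda := (@lebesgue_measure R).
Local Notation sigma := (@spheres_measure R n1 n2).
Variables (F : E -> R) (xi : E).
Hypotheses (mF : measurable_fun setT F) (F0 : forall x, 0 <= F x).
Hypothesis cF : continuous_on cone F.
Variables (K rho : R).
Hypotheses (K0 : 0 <= K) (rho0 : 0 <= rho).
Hypothesis F_le : forall x, cone x -> F x <= K.
Hypothesis F_supp : forall x, cone x -> F x != 0 -> dotp x x <= rho.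

Let P (v : S) := dotp (join_rV v) xi.

(* The density along the ray through v: at the point r v with r = t / P v, where
   [t = <r v, xi>]. It is 0 when P v = 0, by the convention t / 0 = 0. *)
Let G (t : measurableTypeR R) (v : S) := if 0 < t / P v then
  F ((t / P v) *: join_rV v) * (2^-1 * (t / P v) ^+ (n1 + n2 - 3)) * `|P v|^-1
  else 0.

Definition radial_density (t : R) : R := \int[sigma]_(v in unit_spheres) G t v.

Let G_ge0 t v : 0 <= G t v.
Proof.
rewrite /G; case: ifP => // t0.
by rewrite mulr_ge0 ?invr_ge0// mulr_ge0// mulr_ge0// exprn_ge0// ltW.
Qed.

Let mP : measurable_fun setT P.
Proof.
apply: measurable_sum => i; apply: measurable_funM => //.
exact: (measurableT_comp (measurable_rV_coord i) measurable_join_rV).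
Qed.

Let mG : measurable_fun setT (fun p : measurableTypeR R * S => G p.1 p.2).
Proof.
have mq : measurable_fun setT (fun p : measurableTypeR R * S => p.1 / P p.2).
  apply: measurable_funM; first exact: measurable_fst.
  apply: (measurableT_comp (@measurable_invr R)).
  exact: (measurableT_comp mP measurable_snd).
apply: measurable_fun_ifT => //.
  exact: measurable_fun_ltr.
apply: measurable_funM.
  apply: measurable_funM.
    apply: (measurableT_comp mF).
    rewrite (_ : (fun p => _) = cone_polar \o
        (fun p : measurableTypeR R * S => (p.1 / P p.2, p.2))).
      apply: (measurableT_comp measurable_cone_polar).
      by apply/measurable_fun_pairP; split => //; exact: measurable_snd.
    by apply/funext => p /=; rewrite cone_polarE.
  by apply: measurable_funM => //; exact: measurable_funX.
apply: (measurableT_comp (@measurable_invr R)).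
apply: (measurableT_comp (@normr_measurable R setT)).
exact: (measurableT_comp mP measurable_snd).
Qed.

Let mG2 t : measurable_fun setT (G t).
Proof. exact: (measurableT_comp mG (measurable_pair1 t)). Qed.

(** The factor 1 / |P v| is harmless: it equals r / |t| with r = t / P v, and r <= 1 + rho wherever
    [F] does not vanish. For small P v the point r v has left the support. *)
Let G_le t v : t != 0 -> unit_spheres v ->
  G t v <= K * (2^-1 * (1 + rho) ^+ (n1 + n2 - 3)) * ((1 + rho) / `|t|).
Proof.
move=> t0 Sv; have rho1 : 0 <= 1 + rho by rewrite addr_ge0.
rewrite /G; case: ifPn => [r0|_]; last first.
  by rewrite !mulr_ge0// ?exprn_ge0// divr_ge0.
set r := t / P v in r0 *.
have Cr := cone_scale_unit_spheres Sv r0.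
have [->|Fr0] := eqVneq (F (r *: join_rV v)) 0.
  by rewrite !mul0r !mulr_ge0// ?exprn_ge0// divr_ge0.
have r_le : r <= 1 + rho by apply: dotp_polar_le Sv (F_supp Cr Fr0).
have PV : `|P v|^-1 = r / `|t|.
  rewrite -(gtr0_norm r0) normrM normfV mulrAC mulfV ?mul1r// normr_eq0//.
rewrite PV; apply: ler_pM => //.
- by rewrite !mulr_ge0// exprn_ge0// ltW.
- by rewrite divr_ge0// ltW.
- apply: ler_pM => //; first by rewrite mulr_ge0// exprn_ge0// ltW.
    exact: F_le.
  by rewrite ler_wpM2l// lerXn2r// nnegrE ltW.
- by rewrite ler_wpM2r.
Qed.

Let iG t : t != 0 -> sigma.-integrable unit_spheres (EFin \o G t).
Proof.
move=> t0; apply: measurable_bounded_integrable.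
- exact: measurable_unit_spheres.
- by rewrite -ge0_fin_numE// fin_num_measure//; exact: measurable_unit_spheres.
- exact: measurable_funTS.
exists (K * (2^-1 * (1 + rho) ^+ (n1 + n2 - 3)) * ((1 + rho) / `|t|)).
split=> [|M ltM v Sv]; first exact: num_real.
by rewrite /= ger0_norm// (le_trans (G_le t0 Sv))// ltW.
Qed.

Let F_ray_cvg (v : S) (r : R) : unit_spheres v -> 0 < r ->
  F (s *: join_rV v) @[s --> r] --> F (r *: join_rV v).
Proof.
move=> Sv r0; apply/cvgrPdist_le => e e0.
have [d d0 Fd] := cF (cone_scale_unit_spheres Sv r0) e0.
(* [h <= r] keeps s positive; [h <= 1] and [h <= d / 2] bound the squared distance 2 (s - r)^2 by
   [d]. *)
pose h := Num.min r (Num.min 1 (d / 2)).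
have h0 : 0 < h by rewrite !lt_min r0 ltr01 divr_gt0.
near=> s.
have : `|r - s| < h by near: s; exact: cvgr_dist_lt.
rewrite !lt_min !ltr_norml => /andP[/andP[_ rs1] /andP[/andP[rs2 rs3] /andP[rs4 rs5]]].
have s0 : 0 < s by lra.
rewrite distrC; apply: Fd; first exact: cone_scale_unit_spheres.
rewrite /sqdist -scalerBl dotp_polar// expr2.
by nra.
Unshelve. all: by end_near. Qed.

Let G_cont (v : S) t0 : unit_spheres v -> t0 != 0 ->
  {for t0, continuous (fun t => G t v)}.
Proof.
move=> Sv t0_neq0.
have [P0|P_neq0] := eqVneq (P v) 0.
  rewrite (_ : (fun t => _) = cst 0); first exact: cst_continuous.
  by apply/funext => t; rewrite /G P0 invr0 mulr0 ltxx.
have div_cvg : t / P v @[t --> t0] --> t0 / P v by apply: cvgMl; exact: cvg_id.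
have [tP|tP|tP] := ltrgtP (t0 / P v) 0.
- have G0 : G t0 v = 0 by rewrite /G ltNge (ltW tP).
  rewrite /prop_for /continuous_at G0; apply/cvgrPdist_lt => e e0; near=> t.
  rewrite /G ifF ?subrr ?normr0//; apply/negbTE; rewrite -leNgt.
  by apply/ltW; near: t; exact: (cvgr_lt (t0 / P v)).
- have G0 : G t0 v = F ((t0 / P v) *: join_rV v) *
      (2^-1 * (t0 / P v) ^+ (n1 + n2 - 3)) * `|P v|^-1 by rewrite /G tP.
  rewrite /prop_for /continuous_at G0.
  have cvgG : F ((t / P v) *: join_rV v) * (2^-1 * (t / P v) ^+ (n1 + n2 - 3)) *
      `|P v|^-1 @[t --> t0] --> F ((t0 / P v) *: join_rV v) *
      (2^-1 * (t0 / P v) ^+ (n1 + n2 - 3)) * `|P v|^-1.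
    apply: cvgM; last exact: cvg_cst.
    apply: cvgM; first exact: (cvg_comp _ _ div_cvg (F_ray_cvg Sv tP)).
    apply: cvgM; first exact: cvg_cst.
    exact: (cvg_comp _ _ div_cvg (@exprn_continuous R _ _)).
  apply: cvg_trans cvgG; apply: near_eq_cvg; near=> t; rewrite /G ifT//.
  by near: t; exact: (cvgr_gt (t0 / P v)).
- by move/eqP: tP; rewrite mulf_eq0 invr_eq0 (negbTE t0_neq0) (negbTE P_neq0).
Unshelve. all: by end_near. Qed.

Lemma radial_density_continuous t0 : t0 != 0 ->
  {for t0, continuous radial_density}.
Proof.
move=> t0_neq0; have t0_gt0 : 0 < `|t0| by rewrite normr_gt0.
(* On this interval |t| exceeds |t0| / 2, so [G_le] gives the constant [M] as a dominating
   function. *)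
pose u := t0 - `|t0| / 2; pose w := t0 + `|t0| / 2.
have It t : `]u, w[%classic t -> `|t0| / 2 < `|t|.
  rewrite /u /w /= in_itv/= => /andP[h1 h2].
  have := ler_normB t0 (t0 - t); rewrite opprB addrC subrK => h.
  have : `|t0 - t| < `|t0| / 2 by rewrite ltr_norml; apply/andP; split; lra.
  by have := ler_normD t (t0 - t); rewrite [t + _]addrC subrK; lra.
have t_neq0 t : `]u, w[%classic t -> t != 0.
  by move=> /It; rewrite -normr_gt0; apply: le_lt_trans; rewrite divr_ge0.
pose M := K * (2^-1 * (1 + rho) ^+ (n1 + n2 - 3)) * ((1 + rho) / (`|t0| / 2)).
apply: (@continuity_under_integral R _ _ sigma G unit_spheres
  measurable_unit_spheres u w _ _ (fun=> M)).
- by move=> t It0; exact/iG/t_neq0.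
- by apply: aeW => v Sv t /set_mem/t_neq0; exact: G_cont.
- apply: measurable_bounded_integrable => //.
  + exact: measurable_unit_spheres.
  + by rewrite -ge0_fin_numE// fin_num_measure//; exact: measurable_unit_spheres.
  + exists `|M|; split; first exact: num_real.
    by move=> M' /ltW + v Sv; exact.
- move=> t It0; apply: aeW => v Sv; rewrite ger0_norm//.
  apply: (le_trans (G_le (t_neq0 _ It0) Sv)); rewrite ler_wpM2l//.
    by rewrite mulr_ge0// mulr_ge0// exprn_ge0// addr_ge0.
  rewrite ler_wpM2l ?addr_ge0// lef_pV2 ?posrE ?normr_gt0 ?divr_gt0//.
    exact/ltW/It.
  exact: t_neq0.
- by rewrite inE /u /w /= in_itv/=; apply/andP; split; lra.
Qed.

(** Substitution r = t / P v. A ray with P v = 0 is sent entirely to 0, which [B] avoids, and both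
    sides vanish. *)
Let integral_ray (B : set (measurableTypeR R)) (v : S) :
  measurable B -> ~ B 0 ->
  (\int[lambda]_(r in `]0%R, +oo[)
     ((F (r *: join_rV v) * \1_B (r * P v))%:E *
      (2^-1 * r ^+ (n1 + n2 - 3))%:E) =
   \int[lambda]_t (\1_B t * G t v)%:E)%E.
Proof.
move=> mB B0; rewrite integral_mkcond.
have [P0|P_neq0] := eqVneq (P v) 0.
  transitivity (\int[lambda]_t (cst 0 t : \bar R))%E.
    apply: eq_integral => r _; rewrite patchE; case: ifP => // _.
    by rewrite P0 mulr0 indicE memNset// mulr0 mul0e.
  by apply: eq_integral => t _; rewrite /G P0 invr0 mulr0 ltxx mulr0.
set H := (X in integral _ _ X).
have HE r : H r = (if 0 < r then F (r *: join_rV v) * \1_B (r * P v) *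
    (2^-1 * r ^+ (n1 + n2 - 3)) else 0)%:E.
  rewrite /H patchE; case: ifPn => [/set_mem|/negP rN].
    by rewrite /= in_itv/= andbT => ->; rewrite EFinM.
  rewrite ifF//; apply: contra_notF rN => r0.
  by apply/mem_set; rewrite /= in_itv/= andbT.
rewrite (@ge0_integral_scale _ (P v) H P_neq0).
- apply: eq_integral => t _; rewrite HE /G; case: ifP => _; last by rewrite mul0e mulr0.
  by rewrite divfK// -EFinM; congr EFin; ring.
- rewrite (_ : H = EFin \o (fun r => if 0 < r then F (r *: join_rV v) *
    \1_B (r * P v) * (2^-1 * r ^+ (n1 + n2 - 3)) else 0)).
    apply/measurable_EFinP; apply: measurable_fun_ifT => //.
      exact: measurable_fun_ltr.
    apply: measurable_funM.
      apply: measurable_funM.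
        apply: (measurableT_comp mF).
        rewrite (_ : (fun r => _) = cone_polar \o (fun r : measurableTypeR R => (r, v))).
          by apply: (measurableT_comp measurable_cone_polar); exact: measurable_pair2.
        by apply/funext => r /=; rewrite cone_polarE.
      apply: (measurableT_comp (measurable_indic mB)).
      exact: (@mulrr_measurable R setT (P v)).
    by apply: measurable_funM => //; exact: exprn_measurable.
  by apply/funext => r; rewrite HE.
- move=> r; rewrite HE lee_fin; case: ifP => // r0.
  by rewrite mulr_ge0// mulr_ge0// exprn_ge0// ltW.
Qed.

Lemma integral_radial_density (B : set (measurableTypeR R)) :
  measurable B -> ~ B 0 ->
  (\int[cone_measure]_(x in [set x | B (dotp x xi)]) (F x)%:E =
   \int[lambda]_(t in B) (radial_density t)%:E)%E.
Proof.
move=> mB B0.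
have mdot : measurable_fun setT (fun x : E => dotp x xi).
  apply: measurable_sum => i; apply: measurable_funM => //.
  exact: measurable_rV_coord.
(* Indicators replace the domains, so that Tonelli applies on the whole product. *)
pose f (p : measurableTypeR R * S) : \bar R :=
  (\1_B p.1 * G p.1 p.2 * \1_unit_spheres p.2)%:E.
have mf : measurable_fun setT f.
  apply/measurable_EFinP; apply: measurable_funM.
    apply: measurable_funM => //.
    by apply: (measurableT_comp _ measurable_fst); exact: measurable_indic.
  apply: (measurableT_comp _ measurable_snd).
  exact: (measurable_indic measurable_unit_spheres).
have f0 p : (0 <= f p)%E by rewrite lee_fin mulr_ge0// mulr_ge0.
transitivity (\int[cone_measure]_x (F x * \1_B (dotp x xi))%:E)%E.
  rewrite integral_mkcond; apply: eq_integral => x _; rewrite patchE indicE.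
  rewrite -[x \in [set _ | _]]/(dotp x xi \in B).
  by case: ifP; rewrite ?mulr1 ?mulr0.
rewrite ge0_integral_cone; last 2 first.
- apply/measurable_EFinP; apply: measurable_funM => //.
  by apply: (measurableT_comp _ mdot); exact: measurable_indic.
- by move=> x; rewrite lee_fin mulr_ge0.
transitivity (\int[sigma]_v \int[lambda]_t f (t, v))%E.
  rewrite integral_mkcond; apply: eq_integral => v _; rewrite patchE.
  case: ifPn => [Sv|Sv]; last first.
    by rewrite integral0_eq// => t _; rewrite /f/= [\1_unit_spheres _]indicE (negbTE Sv) mulr0.
  under eq_integral do rewrite dotpZl.
  rewrite integral_ray//; apply: eq_integral => t _.
  by rewrite /f/= [\1_unit_spheres _]indicE Sv mulr1.
rewrite -fubini_tonelli// [RHS]integral_mkcond; apply: eq_integral => t _.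
rewrite patchE; case: ifPn => [/set_mem Bt|Bt]; last first.
  by rewrite integral0_eq// => v _; rewrite /f/= indicE (negbTE Bt) mul0r mul0r.
(* Integrability for t != 0 is what makes the real-valued integral agree with the extended one:
   [fine] would send an infinite value to 0. *)
have t0 : t != 0 by apply/eqP => t0; rewrite t0 in Bt.
rewrite /radial_density /Rintegral fineK; last first.
  exact: (integrable_fin_num measurable_unit_spheres (iG t0)).
rewrite [RHS]integral_mkcond; apply: eq_integral => v _.
rewrite patchE /f/= indicE mem_set// mul1r indicE.
by case: (v \in _); rewrite ?mulr1 ?mulr0.
Qed.

End radial_density.

(** * Positivity of Lebesgue and sphere measures *)

Section lebesgue_rV_positive.
Context (R : realType).

Lemma measurable_rV_box n (c : 'rV[R]_n) (e : R) :
  measurable [set x : 'rV[R]_n | forall i, `|x ord0 i - c ord0 i| <= e].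
Proof.
rewrite (_ : [set x | _] = \bigcap_(i in [set: 'I_n])
    (rV_coord i @^-1` `[c ord0 i - e, c ord0 i + e])).
  apply: fin_bigcap_measurable => // i _; rewrite -[X in measurable X]setTI.
  exact: measurable_rV_coord.
apply/seteqP; split => [x /= h i _|x /= h i].
  by rewrite /= in_itv/= -ler_distl; exact: h.
by have := h i Logic.I; rewrite /= in_itv/= -ler_distl.
Qed.

Lemma lebesgue_rV_box_gt0 n (c : 'rV[R]_n) (e : R) : 0 < e ->
  (0 < lebesgue_rV [set x : 'rV[R]_n | forall i, (`|x ord0 i - c ord0 i| <= e)%R])%E.
Proof.
move=> e0; elim: n c => [|n ih] c /=.
  by rewrite diracE mem_set ?lte01// => -[].
rewrite /pushforward (_ : _ @^-1` _ =
    `[c ord0 ord0 - e, c ord0 ord0 + e] `*` [set x : 'rV[R]_n |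
       forall i, `|x ord0 i - (\row_j c ord0 (lift ord0 j)) ord0 i| <= e]).
  rewrite product_measure1E//; last exact: measurable_rV_box.
  rewrite mule_gt0 ?ih//= lebesgue_measure_itv/= lte_fin ifT.
    by rewrite -EFinB lte_fin; lra.
  by lra.
apply/seteqP; split => -[t x] /= h.
  split; first by have := h ord0; rewrite rV_cons0 in_itv/= -ler_distl.
  by move=> i; have := h (lift ord0 i); rewrite rV_consS !mxE.
move: h => [h1 h2] i; case: (unliftP ord0 i) => [j|] ->.
  by rewrite rV_consS; have := h2 j; rewrite !mxE.
by rewrite rV_cons0 ler_distl; move: h1; rewrite in_itv.
Qed.

Lemma lebesgue_rV_nbhs_gt0 n (c : 'rV[R]_n) (A : set 'rV[R]_n) :
  measurable A -> nbhs c A -> (0 < lebesgue_rV A)%E.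
Proof.
move=> mA /nbhs_ballP[e /= e0 cA]; have e2 : 0 < e / 2 by rewrite divr_gt0.
apply: lt_le_trans (lebesgue_rV_box_gt0 c e2) _.
apply: le_measure; rewrite ?inE//; first exact: measurable_rV_box.
move=> x xc; apply: cA; split => // i j; rewrite (ord1 i) /ball/= distrC.
by apply: le_lt_trans (xc j) _; rewrite ltr_pdivrMr// ltr_pMr// ltr1n.
Qed.

Lemma continuous_dotpl n (y : 'rV[R]_n) : continuous (fun x : 'rV[R]_n => dotp y x).
Proof.
apply: (continuous_big add_continuous) => i _ x; apply: continuousM.
  exact: cst_continuous.
exact: coord_continuous.
Qed.

Lemma continuous_enorm n : continuous (@enorm R n).
Proof.
have cdot : continuous (fun x : 'rV[R]_n => dotp x x).
  apply: (continuous_big add_continuous) => i _ x.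
  by apply: continuousM; exact: coord_continuous.
by move=> x; apply: continuous_comp; [exact: cdot|exact: sqrt_continuous].
Qed.

Lemma sphere_measure_gt0 n (w : 'rV[R]_n) (d : R) : enorm w = 1 -> 0 < d ->
  (0 < sphere_measure [set x | enorm x = 1%R /\ (sqdist w x <= d)%R])%E.
Proof.
case: n w => [|n] w w1 d0.
  by move: w1; rewrite /enorm /dotp big_ord0 sqrtr0 => /esym/eqP; rewrite oner_eq0.
rewrite /sphere_measure mule_gt0//.
have mA : measurable [set x : 'rV[R]_n.+1 | enorm x = 1 /\ sqdist w x <= d].
  rewrite (_ : [set x | _] = @enorm R n.+1 @^-1` [set 1] `&`
      [set x | sqdist w x <= d])//.
  apply: measurableI; last exact: measurable_sqball.
  rewrite -[X in measurable X]setTI.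
  by apply: measurable_enorm => //; exact: measurable_set1.
have dw1 := enorm1_dotp w1.
(* The point w / 2 is interior to the sector over the cap around w. *)
apply: (@lebesgue_rV_nbhs_gt0 _ (2^-1 *: w)).
  rewrite (_ : [set x | _] = @enorm R n.+1 @^-1` `]0, 1] `&`
      @unit_dir R n.+1 @^-1` [set x | enorm x = 1 /\ sqdist w x <= d]).
    apply: measurableI; rewrite -[X in measurable X]setTI.
      exact: measurable_enorm.
    exact: measurable_unit_dir.
  by apply/seteqP; split => x /=; rewrite in_itv.
have cw : enorm (2^-1 *: w) = 2^-1.
  by rewrite /enorm dotpZl dotpZr dw1 mulr1 -expr2 sqrtr_sqr ger0_norm.
set c := 2^-1 *: w in cw *.
have cvg_en : enorm x @[x --> c] --> (2^-1 : R) by rewrite -cw; exact: continuous_enorm.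
(* For the unit vector u = x / |x| one has |u - w|^2 = 2 - 2 <w, u>, so positivity of this
   expression places u in the cap; at w / 2 it equals d / 4. *)
have cvg_w : dotp w x - (1 - d / 2) * enorm x @[x --> c] --> (d / 4 : R).
  rewrite (_ : d / 4 = dotp w c - (1 - d / 2) * 2^-1).
    have cvg_dot : dotp w x @[x --> c] --> dotp w c by exact: continuous_dotpl.
    by apply: cvgB cvg_dot _; apply: cvgM cvg_en; exact: cvg_cst.
  by rewrite /c dotpZr dw1; field.
have near_w : \forall x \near c, 0 < dotp w x - (1 - d / 2) * enorm x.
  by apply: (cvgr_gt _ cvg_w); rewrite divr_gt0.
have near1 : \forall x \near c, enorm x < 1.
  by apply: (cvgr_lt _ cvg_en); rewrite invf_lt1// ltr1n.
have near0 : \forall x \near c, 0 < enorm x.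
  by apply: (cvgr_gt _ cvg_en); rewrite invr_gt0.
near=> x => /=.
have x0 : 0 < enorm x by near: x.
have x1 : enorm x < 1 by near: x.
have xw : 0 < dotp w x - (1 - d / 2) * enorm x by near: x.
have ux : enorm (unit_dir x) = 1 by exact: enorm_unit_dir.
split; first by rewrite x0 ltW.
split => //; have := dotpE w (unit_dir x).
rewrite dw1 (enorm1_dotp ux) /unit_dir dotpZr => dE.
have : 1 - d / 2 < (enorm x)^-1 * dotp w x.
  by rewrite [ltRHS]mulrC ltr_pdivlMr//; lra.
by move: dE; set z := _^-1 * _; lra.
Unshelve. all: by end_near. Qed.

End lebesgue_rV_positive.

(** * Finiteness and full support of the cone measure *)

Section cone_measure_bounds.
Context {R : realType} {n1 n2 : nat}.
Local Notation E := 'rV[R]_(n1 + n2).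
Local Notation S := ('rV[R]_n1 * 'rV[R]_n2)%type.
Local Notation lambda := (@lebesgue_measure R).
Local Notation sigma := (@spheres_measure R n1 n2).
Local Notation weight := (fun p : measurableTypeR R * S =>
  2^-1 * p.1 ^+ (n1 + n2 - 3)).

Definition cone_ball (rho : R) : set E := cone `&` [set x | dotp x x <= rho].

Lemma measurable_cone_ball rho : measurable (cone_ball rho).
Proof.
apply: measurableI; first exact: measurable_cone.
rewrite (_ : [set x | _] = (fun x => dotp x x) @^-1` `]-oo, rho]).
  rewrite -[X in measurable X]setTI.
  by apply: measurable_dotp => //; exact: measurable_itv.
by apply/seteqP; split => x; rewrite /= in_itv.
Qed.

Let measurable_weight : measurable_fun setT weight.
Proof. by apply: measurable_funM => //; apply: measurable_funX; exact: measurable_fst. Qed.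

Let measurable_polar (A : set E) : measurable A ->
  measurable [set p : measurableTypeR R * S | (0 < p.1)%R /\ A (cone_polar p)].
Proof.
move=> mA.
rewrite (_ : [set p | _] = fst @^-1` `]0, +oo[ `&` cone_polar @^-1` A).
  apply: measurableI; rewrite -[X in measurable X]setTI.
    by apply: measurable_fst => //; exact: measurable_itv.
  exact: measurable_cone_polar.
by apply/seteqP; split=> p /=; rewrite in_itv/= andbT.
Qed.

Lemma cone_measure_ball_lty (rho : R) : 0 <= rho ->
  (cone_measure (cone_ball rho) < +oo)%E.
Proof.
(* Off the unit spheres a bound on |r v| does not bound r, so this null set is removed before
   estimating. *)
move=> rho0; pose N : set (measurableTypeR R * S) := setT `*` ~` unit_spheres.
have mSc : measurable (~` @unit_spheres R n1 n2).
  by apply: measurableC; exact: measurable_unit_spheres.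
have mN : measurable N by exact: measurableX.
have N0 : (lambda \x sigma)%E N = 0.
  transitivity (lambda setT * sigma (~` unit_spheres))%E.
    exact: (product_measure1E _ _ measurableT mSc).
  by rewrite spheres_measure_setC mule0.
have mA := measurable_polar (measurable_cone_ball rho).
rewrite /cone_measure (ge0_negligible_integral mN mA _ _ N0).
- set A := (X in integral _ (X `\` N) _) in mA *.
  have mAN : measurable (A `\` N) by exact: measurableD.
  have AN p : (A `\` N) p -> [/\ 0 < p.1, p.1 <= 1 + rho & unit_spheres p.2].
    move: p => [r v] [[r0 [_ rv]] notN].
    have Sv : unit_spheres v by apply: contrapT => nSv; apply: notN.
    split => //=.
    by apply: (dotp_polar_le rho0 Sv); rewrite -cone_polarE; exact: rv.
  pose c : R := 2^-1 * (1 + rho) ^+ (n1 + n2 - 3).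
  have c0 : 0 <= c by rewrite mulr_ge0// exprn_ge0// addr_ge0.
  apply: (@le_lt_trans _ _ (c%:E * (lambda \x sigma)%E (A `\` N))%E).
    have w_ge0 p : (A `\` N) p -> 0 <= weight p.
      by move=> /AN[p0 _ _]; rewrite mulr_ge0// exprn_ge0// ltW.
    rewrite (eq_integral (fun p => `|(weight p)%:E|%E)); last first.
      by move=> p /set_mem/w_ge0 wp; rewrite gee0_abs.
    apply: integral_le_bound => //.
      by apply/measurable_EFinP; exact: measurable_funTS.
    apply: aeW => p ANp; rewrite gee0_abs ?lee_fin ?w_ge0//.
    have [p0 p1 _] := AN _ ANp.
    by rewrite ler_wpM2l// lerXn2r// nnegrE ?ltW ?addr_ge0// ltr_wpDr.
  rewrite lte_mul_pinfty//.
  apply: (@le_lt_trans _ _ ((lambda \x sigma)%E (`[0, 1 + rho] `*` unit_spheres))).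
    apply: le_measure; rewrite ?inE//.
      by apply: measurableX => //; exact: measurable_unit_spheres.
    by move=> p /AN[p0 p1 Sp]; split => //=; rewrite in_itv/= ltW.
  rewrite product_measure1E//; last exact: measurable_unit_spheres.
  rewrite lte_mul_pinfty//.
    by rewrite /= lebesgue_measure_itv/=; case: ifP => // _; rewrite -EFinB.
  by rewrite -ge0_fin_numE// fin_num_measure//; exact: measurable_unit_spheres.
- by apply/measurable_EFinP; exact: measurable_funTS.
- by move=> p [p0 _]; rewrite lee_fin mulr_ge0// exprn_ge0// ltW.
Qed.

Lemma cone_measure_sqball_gt0 (x0 : E) (r : R) : cone x0 -> 0 < r ->
  (0 < cone_measure (cone `&` [set x | (sqdist x0 x <= r)%R]))%E.
Proof.
move=> [x0_neq0 Q0] r_gt0; set a := lsubmx x0; set b := rsubmx x0.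
have ab : dotp a a = dotp b b by apply/eqP; rewrite -subr_eq0 -quadQE Q0.
have x0E : x0 = row_mx a b by rewrite hsubmxK.
pose s := enorm a.
have s2 : s ^+ 2 = dotp a a by rewrite sqr_sqrtr// dotp_ge0.
have s_gt0 : 0 < s.
  rewrite lt_def sqrtr_ge0 andbT -sqrf_eq0 s2.
  apply: contra x0_neq0 => /eqP a0.
  by rewrite -dotp_eq0 x0E dotp_row_mx -ab a0 addr0.
pose w1 := s^-1 *: a; pose w2 := s^-1 *: b.
have unit_w n (c : 'rV[R]_n) : s ^+ 2 = dotp c c -> enorm (s^-1 *: c) = 1.
  move=> sc; rewrite /enorm dotpZl dotpZr -sc mulrA -invfM -expr2 mulVf ?sqrtr1//.
  by rewrite sqrf_eq0 gt_eqF.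
have e1 : enorm w1 = 1 by exact: unit_w.
have e2 : enorm w2 = 1 by apply: unit_w; rewrite s2.
have x0s : x0 = s *: join_rV (w1, w2).
  rewrite /join_rV/= /w1 /w2 scale_row_mx !scalerA mulfV ?gt_eqF// !scale1r.
  exact: x0E.
(* For |t - s| <= h this gives s / 2 <= t <= 2 s and (t - s)^2 <= h <= r / 8. With [d] below,
   [sqdist_le] through the point t (w1, w2) bounds the squared distance to x0 by 2 (r / 4 + r / 4) =
   r. *)
pose h := Num.min (s / 2) (Num.min 1 (r / 8)).
have h_gt0 : 0 < h by rewrite !lt_min ltr01 !divr_gt0.
have [h1 [h2 h3]] : h <= s / 2 /\ h <= 1 /\ h <= r / 8.
  by split; [|split]; rewrite !ge_min lexx ?orbT.
pose d := r / (32 * s ^+ 2).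
have d_gt0 : 0 < d by rewrite divr_gt0// mulr_gt0// exprn_gt0.
pose U n (w : 'rV[R]_n) := [set x | enorm x = 1 /\ sqdist w x <= d].
have mU n (w : 'rV[R]_n) : measurable (U n w).
  rewrite (_ : U n w = @enorm R n @^-1` [set 1] `&` [set x | sqdist w x <= d])//.
  apply: measurableI; last exact: measurable_sqball.
  rewrite -[X in measurable X]setTI.
  by apply: measurable_enorm => //; exact: measurable_set1.
pose B : set (measurableTypeR R * S) := `[s - h, s + h] `*` (U _ w1 `*` U _ w2).
have mB : measurable B by apply: measurableX => //; exact: measurableX.
have B_gt0 : (0 < (lambda \x sigma)%E B)%E.
  rewrite product_measure1E//; last exact: measurableX.
  rewrite mule_gt0//=.
    rewrite lebesgue_measure_itv/= lte_fin ifT; last by lra.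
    by rewrite -EFinB lte_fin; lra.
  rewrite /spheres_measure product_measure1E; [|exact: mU|exact: mU].
  by rewrite mule_gt0//; exact: sphere_measure_gt0.
have BA p : B p -> 0 < p.1 /\ (cone `&` [set x | sqdist x0 x <= r]) (cone_polar p).
  move: p => [t [v1 v2]] [/= + [[v1_1 wv1] [v2_1 wv2]]].
  rewrite in_itv/= => /andP[t1 t2]; have t_gt0 : 0 < t by lra.
  have Sv : unit_spheres (v1, v2) by [].
  have Sw : unit_spheres (w1, w2) by [].
  split => //; rewrite cone_polarE; split; first exact: cone_scale_unit_spheres.
  rewrite /= x0s (le_trans (sqdist_le _ (t *: join_rV (w1, w2)) _))//.
  rewrite {1}/sqdist -scalerBl dotp_polar//.
  rewrite /sqdist -scalerBr dotpZl dotpZr /join_rV opp_row_mx add_row_mx dotp_row_mx/=.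
  rewrite -[dotp (v1 - w1) _]/(sqdist w1 v1) -[dotp (v2 - w2) _]/(sqdist w2 v2).
  have st : (s - t) ^+ 2 <= r / 8.
    rewrite (le_trans _ h3)// -real_normK ?num_real// expr2.
    have sth : `|s - t| <= h by rewrite distrC ler_distl t1.
    by rewrite (le_trans (ler_pM _ _ sth (le_trans sth h2)))// mulr1.
  have q12 : sqdist w1 v1 + sqdist w2 v2 <= d + d by exact: lerD.
  have t2s : t <= 2 * s by lra.
  have : t * (t * (sqdist w1 v1 + sqdist w2 v2)) <= 2 * s * (2 * s * (d + d)).
    have q_ge0 : 0 <= sqdist w1 v1 + sqdist w2 v2 by rewrite addr_ge0// dotp_ge0.
    by apply: ler_pM => //; [exact: ltW|rewrite mulr_ge0// ltW|apply: ler_pM => //; exact: ltW].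
  have -> : 2 * s * (2 * s * (d + d)) = r / 4 by rewrite /d; field; rewrite gt_eqF.
  by lra.
have c_gt0 : (0 < (2^-1 * (s / 2) ^+ (n1 + n2 - 3))%:E * (lambda \x sigma) B)%E.
  apply: mule_gt0; last exact: B_gt0.
  by rewrite lte_fin mulr_gt0// exprn_gt0// divr_gt0.
apply: (lt_le_trans c_gt0); rewrite /cone_measure -integral_cst//.
have mC : measurable (cone `&` [set x | sqdist x0 x <= r]).
  by apply: measurableI; [exact: measurable_cone|exact: measurable_sqball].
apply: (@le_trans _ _ (\int[lambda \x sigma]_(p in B) (weight p)%:E)%E).
  apply: ge0_le_integral => //.
  - by move=> p _; rewrite lee_fin mulr_ge0// exprn_ge0// divr_ge0// ltW.
  - by apply/measurable_EFinP; exact: measurable_funTS.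
  - move=> [t v] [/= + _]; rewrite in_itv/= => /andP[t1 t2].
    have s20 : 0 <= s / 2 by rewrite divr_ge0// ltW.
    by rewrite lee_fin ler_wpM2l// lerXn2r// ?nnegrE//; lra.
apply: ge0_subset_integral => //.
- exact: measurable_polar.
- by apply/measurable_EFinP; exact: measurable_funTS.
- by move=> p [p0 _]; rewrite lee_fin mulr_ge0// exprn_ge0// ltW.
Qed.

End cone_measure_bounds.

(** * The Radon transform *)

Section density_existence.
Context {R : realType} {n1 n2 : nat}.
Local Notation E := 'rV[R]_(n1 + n2).
Local Notation lambda := (@lebesgue_measure R).
Implicit Types (f h : E -> R) (xi : E).

Definition bounded_on_cone f := exists K rho, [/\ 0 <= K, 0 <= rho,
  forall x, cone x -> `|f x| <= K & forall x, cone x -> f x != 0 -> dotp x x <= rho].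

(** Integrability of [g] on [B] is part of the conclusion because the densities of the positive and
    negative parts are subtracted afterwards. *)
Lemma nonneg_radon_density h xi : continuous_on cone h -> bounded_on_cone h ->
  (forall x, cone x -> 0 <= h x) ->
  exists g : R -> R, (forall t, t != 0 -> {for t, continuous g}) /\
  forall B : set (measurableTypeR R), measurable B -> ~ B 0 ->
    lambda.-integrable B (EFin \o g) /\
    (\int[cone_measure]_(x in cone `&` [set x | B (dotp x xi)]) (h x)%:E =
     \int[lambda]_(t in B) (g t)%:E)%E.
Proof.
move=> ch [K [rho [K0 rho0 hK h_supp]]] h0.
pose F := h \_ cone.
have FE x : cone x -> F x = h x by move=> Cx; rewrite /F patchE mem_set.
have mF : measurable_fun setT F.
  exact: ((measurable_restrictT h measurable_cone).1
    (continuous_on_measurable measurable_cone ch)).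
have F0 x : 0 <= F x.
  by rewrite /F patchE; case: ifPn => // /set_mem; exact: h0.
have cF : continuous_on cone F.
  move=> x Cx e e0; have [r r0 xr] := ch _ Cx _ e0; exists r => // y Cy xy.
  by rewrite !FE//; exact: xr.
have F_le x : cone x -> F x <= K.
  by move=> Cx; rewrite FE// (le_trans (ler_norm _))// hK.
have F_supp x : cone x -> F x != 0 -> dotp x x <= rho.
  by move=> Cx; rewrite FE//; exact: h_supp.
have g_cont t : t != 0 -> {for t, continuous (radial_density F xi)}.
  exact: (radial_density_continuous mF F0 cF K0 rho0 F_le F_supp).
exists (radial_density F xi); split => // B mB B0.
have intE := integral_radial_density xi mF F0 K0 rho0 F_le F_supp mB B0.
have mBF : measurable [set x : E | B (dotp x xi)].
  have mdot : measurable_fun setT (fun x : E => dotp x xi : measurableTypeR R).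
    apply: measurable_sum => i; apply: measurable_funM => //.
    exact: measurable_rV_coord.
  by rewrite -[X in measurable X]setTI; exact: (mdot measurableT _ mB).
split; last first.
  rewrite -intE integral_mkcondl; apply: eq_integral => x _.
  by rewrite /F !patchE; case: ifP.
apply/integrableP; split.
  apply/measurable_EFinP.
  (* Continuity is known only off 0, which suffices as [B] avoids 0. *)
  have mg : measurable_fun (~` [set (0 : R)]) (radial_density F xi).
    apply: open_continuous_measurable_fun.
      by rewrite openC; exact: closed_eq.
    by move=> t; rewrite inE => /eqP; exact: g_cont.
  apply: (measurable_funS _ _ mg).
    by apply: measurableC; exact: measurable_set1.
  by move=> t Bt /= t0; rewrite t0 in Bt.
have g0 t : 0 <= radial_density F xi t.
  by apply: Rintegral_ge0 => v _; case: ifP => // t0; rewrite mulr_ge0 ?invr_ge0//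
    mulr_ge0// mulr_ge0// exprn_ge0// ltW.
under eq_integral do rewrite /= ger0_norm//.
rewrite -intE; apply: (@le_lt_trans _ _ (\int[cone_measure]_x (F x)%:E)%E).
  apply: ge0_subset_integral => //; first exact/measurable_EFinP.
  by move=> x _; rewrite lee_fin.
have -> : (\int[cone_measure]_x (F x)%:E =
           \int[cone_measure]_(x in cone_ball rho) (F x)%:E)%E.
  rewrite [RHS]integral_mkcond; apply: eq_integral => x _.
  rewrite patchE; case: ifPn => // /negP xN; congr EFin; apply/eqP/negPn/negP => Fx.
  apply: xN; apply/mem_set; have Cx : cone x.
    by apply: contrapT => NCx; move: Fx; rewrite /F patchE memNset// eqxx.
  by split => //; exact: F_supp.
apply: (@le_lt_trans _ _ (K%:E * cone_measure (cone_ball rho : set E))%E).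
  rewrite -integral_cst; last exact: measurable_cone_ball.
  apply: ge0_le_integral => //.
  - exact: measurable_cone_ball.
  - by move=> x _; rewrite lee_fin.
  - by apply/measurable_EFinP; exact: measurable_funTS.
  - by move=> x [Cx _]; rewrite lee_fin F_le.
by rewrite lte_mul_pinfty//; exact: cone_measure_ball_lty.
Qed.

Lemma radon_density_exists f xi : continuous_on cone f -> bounded_on_cone f ->
  exists g, radon_density f xi g.
Proof.
move=> cf [K [rho [K0 rho0 fK f_supp]]].
(* The signs 1 and -1 produce the positive and the negative part of [f]. *)
have posP (s : R) : `|s| = 1 -> exists g : R -> R,
    (forall t, t != 0 -> {for t, continuous g}) /\
    forall B : set (measurableTypeR R), measurable B -> ~ B 0 ->
    lambda.-integrable B (EFin \o g) /\
    (\int[cone_measure]_(x in cone `&` [set x | B (dotp x xi)])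
       (Num.max (s * f x) 0)%:E = \int[lambda]_(t in B) (g t)%:E)%E.
  move=> s1; apply: nonneg_radon_density.
  - move=> x Cx e e0; have [r r0 xr] := cf _ Cx _ e0; exists r => // y Cy xy.
    apply: le_trans (xr _ Cy xy).
    have -> : `|f y - f x| = `|s * f y - s * f x| by rewrite -mulrBr normrM s1 mul1r.
    rewrite !maxEle; case: ifPn => h1; case: ifPn => h2; rewrite ?subrr ?normr0//.
    + by rewrite sub0r normrN -ltNge in h2 *; rewrite gtr0_norm// ler_normr; apply/orP; right; lra.
    + rewrite -ltNge in h1; rewrite subr0 gtr0_norm// ler_normr; apply/orP; left; lra.
  - exists K, rho; split => // x Cx.
      apply: le_trans (fK _ Cx); rewrite -[leRHS]mul1r -s1 -normrM maxEle.
      by case: ifP; rewrite ?normr0.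
    move=> fx; apply: f_supp => //; apply: contra fx => /eqP ->.
    by rewrite mulr0 maxxx.
  - by move=> x _; rewrite le_max lexx orbT.
have [gp [cgp gpE]] := posP 1 (normr1 _).
have [gn [cgn gnE]] := posP (-1) (normrN1 _).
exists (fun t => gp t - gn t); split.
  by move=> t t0; apply: continuousB; [exact: cgp|exact: cgn].
move=> B mB B0; have [igp pE] := gpE B mB B0; have [ign nE] := gnE B mB B0.
rewrite integralB_EFin// -pE -nE integralE; congr (_ - _)%E.
  by apply: eq_integral => x _; rewrite funeposE -EFin_max mul1r.
by apply: eq_integral => x _; rewrite funenegE -EFinN -EFin_max mulN1r.
Qed.

End density_existence.

Section radon_injective.
Context {R : realType} {n1 n2 : nat}.
Local Notation E := 'rV[R]_(n1 + n2).
Implicit Types (f g : E -> R) (xi : E).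

Lemma radonR_density f xi : continuous_on cone f -> bounded_on_cone f ->
  radon_density f xi (radonR f xi).
Proof. by move=> cf bf; apply: getPex; exact: radon_density_exists. Qed.

Let measurable_dotpl xi (B : set (measurableTypeR R)) : measurable B ->
  measurable [set x : E | B (dotp x xi)].
Proof.
move=> mB; have mdot : measurable_fun setT (fun x : E => dotp x xi : measurableTypeR R).
  apply: measurable_sum => i; apply: measurable_funM => //.
  exact: measurable_rV_coord.
by rewrite -[X in measurable X]setTI; exact: (mdot measurableT _ mB).
Qed.

Let bounded_cone_ball_patch f rho : continuous_on cone f -> bounded_on_cone f ->
  bounded_mfun_on (cone_ball rho) (f \_ cone).
Proof.
move=> cf [K [_ [_ _ fK _]]]; split.
  exact: ((measurable_restrictT f measurable_cone).1
    (continuous_on_measurable measurable_cone cf)).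
by exists K => x [Cx _]; rewrite patchE mem_set// fK.
Qed.

Let Rintegral_cone_ball f rho (A : set E) :
  (forall x, cone x -> f x != 0 -> dotp x x <= rho) ->
  \int[cone_measure]_(x in cone_ball rho `&` A) (f \_ cone) x =
  \int[cone_measure]_(x in cone `&` A) f x.
Proof.
move=> f_supp; rewrite Rintegral_mkcond [RHS]Rintegral_mkcond.
apply: eq_Rintegral => x _; rewrite !patchE.
have [Ax|nAx] := pselect (A x); last by rewrite !memNset// => -[].
have [Cx|nCx] := pselect (cone x); last first.
  have nCAx : ~ (cone `&` A) x by case.
  by rewrite (memNset nCx) (memNset nCAx) if_same.
have CAx : (cone `&` A) x by [].
rewrite (mem_set Cx) (mem_set CAx).
have [fx|fx] := eqVneq (f x) 0; first by rewrite fx if_same.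
by rewrite ifT//; apply/mem_set; split => //; split => //; exact: f_supp.
Qed.

Lemma radonR_inj f g :
  continuous_on cone f -> bounded_on_cone f ->
  continuous_on cone g -> bounded_on_cone g ->
  (forall xi t, cone xi -> t != 0 -> radonR f xi t = radonR g xi t) ->
  forall x, cone x -> f x = g x.
Proof.
move=> cf bf cg bg fg x0 Cx0; apply/eqP/negPn/negP => fgx0.
have [Kf [rf [_ rf0 _ f_supp]]] := bf.
have [Kg [rg [_ rg0 _ g_supp]]] := bg.
(* By [dotp_le], [D] then contains all points of the cone at squared distance at most 1 from a point
   where f or g is nonzero; so [D] contains a relative neighbourhood of x0, whose measure is
   positive. *)
pose rho := 2 * (rf + rg + 1); pose D : set E := cone_ball rho.
have mD : measurable D by exact: measurable_cone_ball.
have rho0 : 0 <= rho by rewrite /rho; lra.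
have muD : (cone_measure D < +oo)%E by exact: cone_measure_ball_lty.
have f_rho x : cone x -> f x != 0 -> dotp x x <= rho.
  by move=> Cx /(f_supp _ Cx); rewrite /rho; lra.
have g_rho x : cone x -> g x != 0 -> dotp x x <= rho.
  by move=> Cx /(g_supp _ Cx); rewrite /rho; lra.
pose u x := (f \_ cone) x + -1 * (g \_ cone) x.
have uE x : cone x -> u x = f x - g x.
  by move=> Cx; rewrite /u !patchE mem_set// mulN1r.
have bfD := bounded_cone_ball_patch rho cf bf.
have bgD := bounded_cone_ball_patch rho cg bg.
have bgD' : bounded_mfun_on D (fun x => -1 * (g \_ cone) x).
  by apply: bounded_mfun_onM => //; exact: bounded_mfun_on_cst.
have bu : bounded_mfun_on D u by exact: bounded_mfun_onD.
have bD i : bounded_mfun_on D (fun x : E => x ord0 i).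
  split; first exact: measurable_rV_coord.
  exists (1 + rho) => x [_ /= xrho]; have := sqr_coord_le x i.
  rewrite -real_normK ?num_real//; set z := `|_|.
  have [z1 _|z1] := leP z 1; first by rewrite (le_trans z1)// lerDl.
  have z0 : 0 <= z by exact: normr_ge0.
  have : z * 1 <= z * z by rewrite ler_wpM2l// ltW.
  by rewrite expr2; lra.
have u0 xi : D xi -> forall B : set (measurableTypeR R),
    measurable B -> ~ B 0 ->
    \int[cone_measure]_(x in D `&` [set x | B (dotp x xi)]) u x = 0.
  move=> [Cxi _] B mB B0.
  have mDB : measurable (D `&` [set x | B (dotp x xi)]).
    by apply: measurableI => //; exact: measurable_dotpl.
  have int_D p : bounded_mfun_on D p ->
      cone_measure.-integrable (D `&` [set x | B (dotp x xi)]) (EFin \o p).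
    move=> bp; apply: (integrableS mD) => //.
    exact: bounded_mfun_on_integrable.
  rewrite (RintegralD mDB (int_D _ bfD) (int_D _ bgD')).
  rewrite (RintegralZl _ mDB (int_D _ bgD)).
  rewrite !Rintegral_cone_ball// /Rintegral.
  have [_ ->//] := radonR_density xi cf bf.
  have [_ ->//] := radonR_density xi cg bg.
  rewrite mulN1r; apply/eqP; rewrite subr_eq0; apply/eqP; congr fine.
  apply: eq_integral => t /set_mem Bt; rewrite fg//.
  by apply/eqP => t0; rewrite t0 in Bt.
have x0_supp : dotp x0 x0 <= rf + rg.
  have [fx0|/(f_supp _ Cx0)] := eqVneq (f x0) 0; last by lra.
  have /(g_supp _ Cx0) : g x0 != 0 by rewrite -fx0 eq_sym.
  by lra.
have Dx0 : D x0 by split => //=; rewrite /rho; lra.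
have : u x0 = 0.
  apply: (eq0_of_projections mD muD bD bu u0 Dx0); first by case: Cx0.
    move=> e e0; have e2 : 0 < e / 2 by rewrite divr_gt0.
    have [r1 r1_gt0 xr1] := cf _ Cx0 _ e2; have [r2 r2_gt0 xr2] := cg _ Cx0 _ e2.
    exists (Num.min r1 r2); first by rewrite lt_min r1_gt0.
    move=> x [Cx _]; rewrite le_min => /andP[/(xr1 _ Cx) h1 /(xr2 _ Cx) h2].
    rewrite !uE// (_ : _ - _ = (f x - f x0) - (g x - g x0)); last by ring.
    by rewrite (le_trans (ler_normB _ _))// (le_trans (lerD h1 h2))// -splitr.
  (* The ball is shrunk to squared radius at most 1 so that its trace on the cone stays inside
     [D]. *)
  move=> r r_gt0; pose s := Num.min r 1.
  have s_gt0 : 0 < s by rewrite lt_min r_gt0 ltr01.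
  apply: lt_le_trans (cone_measure_sqball_gt0 Cx0 s_gt0) _.
  apply: le_measure; rewrite ?inE.
  - by apply: measurableI; [exact: measurable_cone|exact: measurable_sqball].
  - by apply: measurableI => //; exact: measurable_sqball.
  move=> x [Cx /=]; rewrite le_min => /andP[xr x1]; split => //; split => //=.
  by have := dotp_le x x0; rewrite sqdistC /rho; lra.
by rewrite uE// => /eqP; rewrite subr_eq0 (negbTE fgx0).
Qed.

Lemma smooth_on_cone_continuous f : smooth_on_cone f -> continuous_on cone f.
Proof.
move=> sf x Cx e e0; have [U [F [oU Ux sF fF]]] := sf x Cx.
(* The empty list of derivatives yields [F] itself. *)
have [/cvgrPdist_le/(_ _ e0) cF _] := sF [::] x Ux.
have nU : nbhs x U by exact: open_nbhs_nbhs.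
have [r r0 xr] := nbhs_sqdist (filterI cF nU).
exists r => // y Cy xy; have [/= Fxy Uy] := xr _ xy.
by rewrite !fF// distrC.
Qed.

(** Here [g] stands for the real or imaginary part of [f], while compactness is known for the
    support of [f]. *)
Lemma compact_support_bounded_on_cone (f : E -> R[i]) g :
  compact (cone `&` closure (cone `&` [set x | f x != 0])) ->
  continuous_on cone g -> (forall x, g x != 0 -> f x != 0) -> bounded_on_cone g.
Proof.
set K := _ `&` _ => cK cg gf.
have KC : K `<=` cone by exact: subIsetl.
have gK x : cone x -> g x != 0 -> K x.
  by move=> Cx /gf fx; split => //; apply: subset_closure.
have [M gM] : exists M, forall x, K x -> `|g x| <= M.
  apply: (compact_locally_bounded cK KC) => x Cx.
  have [r r0 xr] := cg _ Cx _ ltr01; exists r => //; exists (`|g x| + 1) => y Cy xy.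
  by have := ler_normD (g x) (g y - g x); have := xr _ Cy xy; rewrite subrKC; lra.
have [M' dM] : exists M, forall x, K x -> `|dotp x x| <= M.
  apply: (compact_locally_bounded cK KC) => x Cx.
  exists 1 => //; exists (2 * (dotp x x + 1)) => y Cy xy.
  by rewrite ger0_norm ?dotp_ge0//; have := dotp_le y x; rewrite sqdistC; lra.
exists `|M|, `|M'|; split => // x Cx.
  have [->|gx] := eqVneq (g x) 0; first by rewrite normr0.
  by rewrite (le_trans (gM _ (gK _ Cx gx)))// ler_norm.
by move=> gx; rewrite (le_trans (ler_norm _))// (le_trans (dM _ (gK _ Cx gx)))// ler_norm.
Qed.

End radon_injective.

Theorem corollary1p2p6 (R : realType) (n1 n2 : nat)
    (hn1 : (1 < n1)%N) (hn2 : (1 < n2)%N)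
    (n_even : ~~ odd (n1 + n2)) (n_gt2 : (2 < n1 + n2)%N)
    (f1 f2 : 'rV[R]_(n1 + n2) -> R[i])
    (hf1 : test_function f1) (hf2 : test_function f2)
    (hR : forall (xi : 'rV[R]_(n1 + n2)) (t : R),
       cone xi -> t != 0 -> radon f1 xi t = radon f2 xi t) :
  forall x : 'rV[R]_(n1 + n2), cone x -> f1 x = f2 x.
Proof.
(* The sum of squares in [moment_eq0] forces zero only for real moments, so real and imaginary parts
   are treated separately, in accordance with the definition of [radon]. *)
have ReP (f : 'rV[R]_(n1 + n2) -> R[i]) : test_function f ->
    continuous_on cone (fun x => complex.Re (f x)) /\
    bounded_on_cone (fun x => complex.Re (f x)).
  move=> [/smooth_on_cone_continuous cRe _ cK]; split => //.
  by apply: (compact_support_bounded_on_cone cK cRe) => x; apply: contra => /eqP ->.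
have ImP (f : 'rV[R]_(n1 + n2) -> R[i]) : test_function f ->
    continuous_on cone (fun x => complex.Im (f x)) /\
    bounded_on_cone (fun x => complex.Im (f x)).
  move=> [_ /smooth_on_cone_continuous cIm cK]; split => //.
  by apply: (compact_support_bounded_on_cone cK cIm) => x; apply: contra => /eqP ->.
have [cRe1 bRe1] := ReP _ hf1; have [cRe2 bRe2] := ReP _ hf2.
have [cIm1 bIm1] := ImP _ hf1; have [cIm2 bIm2] := ImP _ hf2.
move=> x Cx; apply/eqP; rewrite eq_complex; apply/andP; split; apply/eqP.
  apply: (radonR_inj cRe1 bRe1 cRe2 bRe2) Cx => xi t Cxi t0.
  by have [] := hR _ _ Cxi t0.
apply: (radonR_inj cIm1 bIm1 cIm2 bIm2) Cx => xi t Cxi t0.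
by have [] := hR _ _ Cxi t0.
Qed.
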